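(* Let $P=(\mathcal{T},\mathcal{C}:A)$ and $Q=(\mathcal{S},\mathcal{D}:B)$ be measuring left $\alpha$-pairings and let $$(\xi,\theta:\beta):(\mathcal{T},\mathcal{C}:A)\to(\mathcal{S},\mathcal{D}:B)$$ be a morphism of measuring left pairings. Then there is a covariant functor $$\mathrm{HOM}_{-\mathcal{S}}^{(\mathcal{C})}(\mathcal{T}\otimes_A B,-):=\mathrm{Rat}^{\mathcal{C}}(-)\circ\mathrm{Hom}_{-\mathcal{S}}(\mathcal{T}\otimes_A B,-):\mathbb{M}_{\mathcal{S}}\to\mathbb{M}^{\mathcal{C}},$$ which restricts (along the embedding $\mathbb{M}^{\mathcal{D}}\hookrightarrow\mathbb{M}_{\mathcal{S}}$) to a functor $$\mathrm{Coind}_{\mathcal{D}}^{\mathcal{C}}(-):\mathbb{M}^{\mathcal{D}}\to\mathbb{M}^{\mathcal{C}},\quad N\mapsto\mathrm{Rat}^{\mathcal{C}}(\mathrm{Hom}_{-\mathcal{S}}(\mathcal{T}\otimes_A B,N)).$$ Moreover $(-\otimes_A B,\ \mathrm{Coind}_{\mathcal{D}}^{\mathcal{C}}(-))$ is an adjoint pair of covariant functors, where $-\otimes_A B:\mathbb{M}^{\mathcal{C}}\to\mathbb{M}^{\mathcal{D}}$ is the induction functor.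
   Context: $R$ is a commutative ring with $1_R\neq0_R$; $A$, $B$ are arbitrary $R$-algebras. An $A$-ring is an $A$-bimodule $\mathcal{T}$ with $A$-bilinear associative multiplication $\mathcal{T}\otimes_A\mathcal{T}\to\mathcal{T}$ and unit $A\to\mathcal{T}$; morphisms are $A$-bilinear maps respecting multiplication and unit. Given an $R$-algebra morphism $\beta:A\to B$, $B$-modules, $B$-bimodules and $B$-rings are regarded as $A$-modules, $A$-bimodules and $A$-rings through $\beta$. Corings: an $A$-coring is an $A$-bimodule $\mathcal{C}$ with $A$-bilinear coassociative comultiplication $\Delta_{\mathcal{C}}:\mathcal{C}\to\mathcal{C}\otimes_A\mathcal{C}$, $c\mapsto\sum c_1\otimes_A c_2$, and $A$-bilinear counit $\varepsilon_{\mathcal{C}}:\mathcal{C}\to A$. A morphism of corings $(\theta:\beta):(\mathcal{C}:A)\to(\mathcal{D}:B)$ is an $R$-algebra morphism $\beta:A\to B$ with an $(A,A)$-bilinear map $\theta:\mathcal{C}\to\mathcal{D}$ such that $\chi\circ(\theta\otimes_A\theta)\circ\Delta_{\mathcal{C}}=\Delta_{\mathcal{D}}\circ\theta$ ($\chi:\mathcal{D}\otimes_A\mathcal{D}\to\mathcal{D}\otimes_B\mathcal{D}$ canonical) and $\varepsilon_{\mathcal{D}}\circ\theta=\beta\circ\varepsilon_{\mathcal{C}}$. $^{\ast}\mathcal{C}:=\mathrm{Hom}_{A-}(\mathcal{C},A)$ (left $A$-linear maps) is an $A$-ring with product $(f\star_l g)(c)=\sum g(c_1f(c_2))$ and unit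 $\varepsilon_{\mathcal{C}}$. Comodules: a right $\mathcal{C}$-comodule is a right $A$-module $M$ with a right $A$-linear coassociative coaction $\varrho_M:M\to M\otimes_A\mathcal{C}$, $m\mapsto\sum m_{<0>}\otimes_A m_{<1>}$; $\mathbb{M}^{\mathcal{C}}$ is the category of counital right $\mathcal{C}$-comodules with colinear maps. Measuring pairings: a measuring left pairing $P=(\mathcal{T},\mathcal{C}:A)$ consists of an $A$-coring $\mathcal{C}$ and an $A$-ring $\mathcal{T}$ with a morphism of $A$-rings $\kappa_P:\mathcal{T}\to{}^{\ast}\mathcal{C}$; write $\langle t,c\rangle:=\kappa_P(t)(c)$. It is a measuring left $\alpha$-pairing if for every right $A$-module $M$ the map $\alpha_M^P:M\otimes_A\mathcal{C}\to\mathrm{Hom}_{-A}(\mathcal{T},M)$, $\sum m_i\otimes_A c_i\mapsto[t\mapsto\sum m_i\langle t,c_i\rangle]$, is injective. A morphism $(\xi,\theta:\beta):(\mathcal{T},\mathcal{C}:A)\to(\mathcal{S},\mathcal{D}:B)$ consists of a morphism of corings $(\theta:\beta):(\mathcal{C}:A)\to(\mathcal{D}:B)$ and a morphism of $A$-rings $\xi:\mathcal{S}\to\mathcal{T}$ with $\langle s,\theta(c)\rangle=\beta(\langle\xi(s),c\rangle)$ for all $s\in\mathcal{S}$, $c\in\mathcal{C}$. Rational modules: for a measuring left $\alpha$-pairing $P$ and a unital right $\mathcal{T}$-module $M$, $\mathrm{Rat}^{\mathcal{C}}(M_{\mathcal{T}})$ is the set of $m\in M$ for which there is a (necessarily unique)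 $\sum m_i\otimes_A c_i\in M\otimes_A\mathcal{C}$ with $mt=\sum m_i\langle t,c_i\rangle$ for all $t\in\mathcal{T}$; it is a right $\mathcal{C}$-comodule via $m\mapsto\sum m_i\otimes_A c_i$. Right $\mathcal{D}$-comodules $N$ are right $\mathcal{S}$-modules via $ns=\sum n_{<0>}\langle s,n_{<1>}\rangle$ (the embedding $\mathbb{M}^{\mathcal{D}}\hookrightarrow\mathbb{M}_{\mathcal{S}}$). Module structures: as part of the setting, $\mathcal{T}\otimes_A B$ is taken as a right $\mathcal{S}$-module through $(\sum t_i\otimes_A b_i)\leftharpoonup s:=\sum t_i\xi(s)\otimes_A b_i$, and for a right $\mathcal{S}$-module $N$, $\mathrm{Hom}_{-\mathcal{S}}(\mathcal{T}\otimes_A B,N)$ (right $\mathcal{S}$-linear maps) is a right $\mathcal{T}$-module through $(\varphi\leftharpoonup\widetilde t)(\sum t_i\otimes_A b_i)=\varphi(\sum\widetilde t\,t_i\otimes_A b_i)$. Induction functor: $-\otimes_A B:\mathbb{M}^{\mathcal{C}}\to\mathbb{M}^{\mathcal{D}}$, where $M\otimes_A B$ is a right $\mathcal{D}$-comodule via $M\otimes_A B\to(M\otimes_A B)\otimes_B\mathcal{D}\simeq M\otimes_A\mathcal{D}$, $m\otimes_A b\mapsto\sum m_{<0>}\otimes_A\theta(m_{<1>})b$. *)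

(* Defs.v *)
From HB Require Import structures.
From mathcomp Require Import all_boot all_order all_algebra.
From mathcomp Require Import boolp.

Set Implicit Arguments.
Unset Strict Implicit.
Unset Printing Implicit Defensive.

Import GRing.Theory.
Local Open Scope ring_scope.
Local Open Scope quotient_scope.

Reserved Notation "a *> x" (at level 40, left associativity).
Reserved Notation "x <* a" (at level 40, left associativity).
Reserved Notation "x ⊗ y" (at level 40, left associativity).

(* [algType R] excludes the zero algebra, which an arbitrary R-algebra may
   be; hence a ring with a central structure morphism. *)
Record ralgebra (R : comNzRingType) := RAlgebra {
  ralg_ring :> pzRingType;
  ralg_map : {rmorphism R -> ralg_ring};
  ralg_central : forall r a, ralg_map r * a = a * ralg_map r }.

Definition is_ralg_mor (R : comNzRingType) (A B : ralgebra R)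
    (f : {rmorphism A -> B}) :=
  forall r, f (ralg_map A r) = ralg_map B r.

Definition is_ract (A : pzRingType) (M : zmodType) (act : M -> A -> M) :=
  [/\ forall m, act m 1 = m,
      forall m a b, act m (a * b) = act (act m a) b,
      forall m n a, act (m + n) a = act m a + act n a &
      forall m a b, act m (a + b) = act m a + act m b].

Definition is_lact (A : pzRingType) (M : zmodType) (act : A -> M -> M) :=
  [/\ forall m, act 1 m = m,
      forall a b m, act (a * b) m = act a (act b m),
      forall a m n, act a (m + n) = act a m + act a n &
      forall a b m, act (a + b) m = act a m + act b m].

Record rmodule (A : pzRingType) := RModule {
  rm_sort :> zmodType;
  ract : rm_sort -> A -> rm_sort;
  ractP : is_ract ract }.

Notation "x <* a" := (ract x a) : ring_scope.

(* A left A-, right B-bimodule. *)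
Record bimodule (A B : pzRingType) := Bimodule {
  bm_rmod :> rmodule B;
  lact : A -> bm_rmod -> bm_rmod;
  lactP : is_lact lact;
  lact_ract : forall a m b, lact a (m <* b) = lact a m <* b }.

Notation "a *> x" := (lact a x) : ring_scope.

Section ActTheory.
Variables (A B : pzRingType) (M : rmodule B) (N : bimodule A B).

Lemma ract1 (m : M) : m <* 1 = m. Proof. by case: (ractP M). Qed.
Lemma ractA (m : M) a b : m <* (a * b) = m <* a <* b.
Proof. by case: (ractP M). Qed.
Lemma ractDl (m n : M) a : (m + n) <* a = m <* a + n <* a.
Proof. by case: (ractP M). Qed.
Lemma ractDr (m : M) a b : m <* (a + b) = m <* a + m <* b.
Proof. by case: (ractP M). Qed.
Lemma lact1 (m : N) : 1 *> m = m. Proof. by case: (lactP N). Qed.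
Lemma lactA a b (m : N) : (a * b) *> m = a *> (b *> m).
Proof. by case: (lactP N). Qed.
Lemma lactDr a (m n : N) : a *> (m + n) = a *> m + a *> n.
Proof. by case: (lactP N). Qed.
Lemma lactDl a b (m : N) : (a + b) *> m = a *> m + b *> m.
Proof. by case: (lactP N). Qed.
End ActTheory.

Definition rlin (A : pzRingType) (M N : rmodule A) (f : M -> N) :=
  {morph f : x y / x + y} /\ (forall x a, f (x <* a) = f x <* a).

Definition llin (A B B' : pzRingType) (M : bimodule A B) (N : bimodule A B')
    (f : M -> N) :=
  {morph f : x y / x + y} /\ (forall a x, f (a *> x) = a *> f x).

Definition bilin (A B : pzRingType) (M N : bimodule A B) (f : M -> N) :=
  [/\ {morph f : x y / x + y}, (forall a x, f (a *> x) = a *> f x) &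
      (forall x b, f (x <* b) = f x <* b)].

Lemma morphD0 (U V : zmodType) (f : U -> V) :
  {morph f : x y / x + y} -> f 0 = 0.
Proof. by move=> fD; apply: (addrI (f 0)); rewrite -fD !addr0. Qed.

Lemma morphDN (U V : zmodType) (f : U -> V) :
  {morph f : x y / x + y} -> {morph f : x / - x}.
Proof.
by move=> fD x; apply: (addrI (f x)); rewrite -fD !subrr (morphD0 fD).
Qed.

Lemma morphD_sum (U V : zmodType) (f : U -> V) (I : Type) (s : seq I)
    (F : I -> U) :
  {morph f : x y / x + y} -> f (\sum_(i <- s) F i) = \sum_(i <- s) f (F i).
Proof. by move=> fD; apply: (big_morph f fD (morphD0 fD)). Qed.

Lemma ract0l (A : pzRingType) (M : rmodule A) a : (0 : M) <* a = 0.
Proof. by apply: (@morphD0 _ _ (fun x : M => x <* a)) => x y; apply: ractDl. Qed.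
Lemma ract0r (A : pzRingType) (M : rmodule A) (m : M) : m <* 0 = 0.
Proof. by apply: (@morphD0 _ _ (fun a => m <* a)) => x y; apply: ractDr. Qed.
Lemma lact0l (A B : pzRingType) (M : bimodule A B) (m : M) : 0 *> m = 0.
Proof. by apply: (@morphD0 _ _ (fun a => a *> m)) => x y; apply: lactDl. Qed.
Lemma lact0r (A B : pzRingType) (M : bimodule A B) a : a *> (0 : M) = 0.
Proof. by apply: (@morphD0 _ _ (fun x : M => a *> x)) => x y; apply: lactDr. Qed.

Section Regular.
Variable A : pzRingType.
Fact reg_ractP : is_ract (fun x a : A => x * a).
Proof.
by split=> *; rewrite ?mulr1 ?mulrA ?mulrDl ?mulrDr.
Qed.
Definition rreg : rmodule A := RModule reg_ractP.
Fact reg_lactP : is_lact (fun a x : A => a * x).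
Proof. by split=> *; rewrite ?mul1r ?mulrA ?mulrDl ?mulrDr. Qed.
Definition breg : bimodule A A :=
  @Bimodule A A rreg (fun a x : A => a * x) reg_lactP (@mulrA A).
End Regular.

Section Restriction.
Variables (A B : pzRingType) (f : {rmorphism A -> B}).

Fact rres_ractP (M : rmodule B) : is_ract (fun (x : M) a => x <* f a).
Proof.
by split=> *; rewrite ?rmorph1 ?rmorphM ?rmorphD ?ract1 ?ractA ?ractDl ?ractDr.
Qed.
Definition rres (M : rmodule B) : rmodule A := RModule (rres_ractP M).

Fact lres_lactP C (M : bimodule B C) : is_lact (fun a (x : M) => f a *> x).
Proof.
by split=> *; rewrite ?rmorph1 ?rmorphM ?rmorphD ?lact1 ?lactA ?lactDl ?lactDr.
Qed.
Definition lres C (M : bimodule B C) : bimodule A C :=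
  @Bimodule A C M (fun a (x : M) => f a *> x) (lres_lactP M)
    (fun a m c => lact_ract (f a) m c).

Definition bres (M : bimodule B B) : bimodule A A :=
  @Bimodule A A (rres M) (fun a (x : M) => f a *> x) (lres_lactP M)
    (fun a m c => lact_ract (f a) m (f c)).
End Restriction.

Section TensorProduct.
Variables (A B : pzRingType) (M : rmodule A) (N : bimodule A B).

(* A list stands for the sum of the pure tensors it contains; [tens_rel] is
   the congruence generated by biadditivity and A-balancedness. *)
Inductive tens_rel : seq (M * N) -> seq (M * N) -> Prop :=
| TensRefl s : tens_rel s s
| TensSym s t : tens_rel s t -> tens_rel t s
| TensTrans s t u : tens_rel s t -> tens_rel t u -> tens_rel s u
| TensCat s s' t t' :
    tens_rel s s' -> tens_rel t t' -> tens_rel (s ++ t) (s' ++ t')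
| TensC s t : tens_rel (s ++ t) (t ++ s)
| Tens0 n : tens_rel [:: (0, n)] [::]
| TensDl m m' n : tens_rel [:: (m + m', n)] [:: (m, n); (m', n)]
| TensDr m n n' : tens_rel [:: (m, n + n')] [:: (m, n); (m, n')]
| TensBal m a n : tens_rel [:: (m <* a, n)] [:: (m, a *> n)].

Definition tens_relb s t : bool := `[< tens_rel s t >].

Fact tens_relb_refl : reflexive tens_relb.
Proof. by move=> s; apply/asboolP; apply: TensRefl. Qed.
Fact tens_relb_sym : symmetric tens_relb.
Proof. by move=> s t; apply/asboolP/asboolP; apply: TensSym. Qed.
Fact tens_relb_trans : transitive tens_relb.
Proof.
by move=> t s u /asboolP st /asboolP tu; apply/asboolP; apply: TensTrans tu.
Qed.
Canonical tens_equiv :=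
  EquivRel tens_relb tens_relb_refl tens_relb_sym tens_relb_trans.

Definition tens_sort := {eq_quot tens_equiv}.
HB.instance Definition _ := Choice.on tens_sort.

Definition tens_of (s : seq (M * N)) : tens_sort := \pi_tens_sort s.

Lemma tens_ofP s t : tens_of s = tens_of t <-> tens_rel s t.
Proof.
split=> [/eqP|st]; first by rewrite eqmodE => /asboolP.
by apply/eqP; rewrite eqmodE; apply/asboolP.
Qed.

Lemma tens_repr x : tens_of (repr x) = x. Proof. exact: reprK. Qed.

Definition tens_add (x y : tens_sort) := tens_of (repr x ++ repr y).
Definition tens_opp (x : tens_sort) :=
  tens_of [seq (- p.1, p.2) | p <- repr x].

Lemma tens_add_of s t : tens_add (tens_of s) (tens_of t) = tens_of (s ++ t).
Proof.
by apply/tens_ofP; apply: TensCat; apply/tens_ofP; rewrite tens_repr.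
Qed.

Fact tens_addA : associative tens_add.
Proof.
move=> x y z; rewrite -(tens_repr x) -(tens_repr y) -(tens_repr z).
by rewrite !tens_add_of catA.
Qed.
Fact tens_addC : commutative tens_add.
Proof. by move=> x y; apply/tens_ofP; apply: TensC. Qed.
Fact tens_add0 : left_id (tens_of [::]) tens_add.
Proof. by move=> x; rewrite -(tens_repr x) tens_add_of. Qed.
Fact tens_addN : left_inverse (tens_of [::]) tens_opp tens_add.
Proof.
move=> x; rewrite -{2}(tens_repr x) tens_add_of.
elim: (repr x) => [|[m n] s IHs] //=.
apply: etrans IHs; apply/tens_ofP.
set s' := map _ _.
apply: (@TensTrans _ ([:: (- m, n); (m, n)] ++ (s' ++ s))).
  have -> : (- m, n) :: s' ++ (m, n) :: s =
      [:: (- m, n)] ++ ((s' ++ [:: (m, n)]) ++ s) by rewrite -catA.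
  have -> : [:: (- m, n); (m, n)] ++ (s' ++ s) =
      [:: (- m, n)] ++ (([:: (m, n)] ++ s') ++ s) by [].
  apply: TensCat; first exact: TensRefl.
  by apply: TensCat; [apply: TensC | apply: TensRefl].
rewrite -[X in tens_rel _ X]cat0s; apply: (TensCat _ (TensRefl _)).
apply: (TensTrans (TensSym (TensDl _ _ _))).
by rewrite addNr; apply: Tens0.
Qed.
HB.instance Definition _ := GRing.isZmodule.Build tens_sort
  tens_addA tens_addC tens_add0 tens_addN.

Definition raw_tpure (m : M) (n : N) : tens_sort := tens_of [:: (m, n)].
Local Notation "m ⊙ n" := (raw_tpure m n) (at level 40).

Lemma raw_tpureDl m m' n : (m + m') ⊙ n = m ⊙ n + m' ⊙ n.
Proof. by rewrite [RHS]tens_add_of; apply/tens_ofP; apply: TensDl. Qed.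
Lemma raw_tpureDr m n n' : m ⊙ (n + n') = m ⊙ n + m ⊙ n'.
Proof. by rewrite [RHS]tens_add_of; apply/tens_ofP; apply: TensDr. Qed.
Lemma raw_tpure_bal m a n : (m <* a) ⊙ n = m ⊙ (a *> n).
Proof. by apply/tens_ofP; apply: TensBal. Qed.

Lemma tens_of_sum s : tens_of s = \sum_(p <- s) p.1 ⊙ p.2.
Proof.
elim: s => [|[m n] s IHs]; first by rewrite big_nil.
by rewrite big_cons -IHs [RHS]tens_add_of.
Qed.

Lemma raw_tens_sumE x : x = \sum_(p <- repr x) p.1 ⊙ p.2.
Proof. by rewrite -tens_of_sum tens_repr. Qed.

Lemma raw_tens_ind (P : tens_sort -> Prop) :
  (forall m n, P (m ⊙ n)) -> (forall x y, P x -> P y -> P (x + y)) ->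
  forall x, P x.
Proof.
move=> Pp PD x; rewrite (raw_tens_sumE x); elim: (repr x) => [|[m n] s IHs].
  rewrite big_nil (_ : 0 = 0 ⊙ 0) //.
  by apply: (addrI (0 ⊙ 0)); rewrite -raw_tpureDl !addr0.
by rewrite big_cons; apply: PD.
Qed.

Definition balanced (G : zmodType) (f : M -> N -> G) :=
  [/\ forall m m' n, f (m + m') n = f m n + f m' n,
      forall m n n', f m (n + n') = f m n + f m n' &
      forall m a n, f (m <* a) n = f m (a *> n)].

Definition raw_tlift (G : zmodType) (f : M -> N -> G) (x : tens_sort) : G :=
  \sum_(p <- repr x) f p.1 p.2.

Lemma raw_tlift_of (G : zmodType) (f : M -> N -> G) s :
  balanced f -> raw_tlift f (tens_of s) = \sum_(p <- s) f p.1 p.2.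
Proof.
case=> fl fr fb; rewrite /raw_tlift.
have: tens_rel (repr (tens_of s)) s by apply/tens_ofP; rewrite tens_repr.
move: (repr _) => t; elim=> //=.
- by move=> ? ? ? _ -> _ ->.
- by move=> s1 s2 t1 t2 _ e1 _ e2; rewrite !big_cat /= e1 e2.
- by move=> s1 s2; rewrite !big_cat /= addrC.
- move=> n; rewrite big_nil big_seq1 /=.
  by apply: (@morphD0 _ _ (fun m => f m n)) => x y; apply: fl.
- by move=> m m' n; rewrite big_seq1 big_cons big_seq1 /= fl.
- by move=> m n n'; rewrite big_seq1 big_cons big_seq1 /= fr.
- by move=> m a n; rewrite !big_seq1 /= fb.
Qed.

Lemma raw_tlift_pure (G : zmodType) (f : M -> N -> G) m n :
  balanced f -> raw_tlift f (m ⊙ n) = f m n.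
Proof. by move=> fb; rewrite raw_tlift_of // big_seq1. Qed.

Lemma raw_tliftD (G : zmodType) (f : M -> N -> G) :
  balanced f -> {morph raw_tlift f : x y / x + y}.
Proof.
move=> fb x y; rewrite -(tens_repr x) -(tens_repr y) [_ + _]tens_add_of.
by rewrite !raw_tlift_of // big_cat.
Qed.

Definition tens_ract (x : tens_sort) (b : B) : tens_sort :=
  raw_tlift (fun m n => m ⊙ (n <* b)) x.

Fact tens_ract_bal b : balanced (fun m n => m ⊙ (n <* b)).
Proof.
split=> *; rewrite ?raw_tpureDl ?ractDl ?raw_tpureDr //.
by rewrite raw_tpure_bal lact_ract.
Qed.

Fact tens_ractP : is_ract tens_ract.
Proof.
have D b := raw_tliftD (tens_ract_bal b).
have E m n b : tens_ract (m ⊙ n) b = m ⊙ (n <* b).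
  exact: raw_tlift_pure (tens_ract_bal b).
split=> [x|x a b|x y a|x a b].
- by elim/raw_tens_ind: x => [m n|x y]; rewrite ?E ?ract1 // /tens_ract D => -> ->.
- elim/raw_tens_ind: x => [m n|x y]; first by rewrite !E ractA.
  by rewrite /tens_ract !D => -> ->.
- exact: D.
- elim/raw_tens_ind: x => [m n|x y]; first by rewrite !E ractDr raw_tpureDr.
  by rewrite /tens_ract !D => -> ->; rewrite addrACA.
Qed.

Definition tens : rmodule B := RModule tens_ractP.

Definition tpure (m : M) (n : N) : tens := raw_tpure m n.
Local Notation "m ⊗ n" := (tpure m n).

(* The additive map induced by [f].  It is a total function of [f], and
   meaningful (independent of representatives) for balanced [f] only: see
   [raw_tlift_pure] and [raw_tliftD]. *)
Definition tlift (G : zmodType) (f : M -> N -> G) (x : tens) : G :=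
  raw_tlift f x.

Lemma tpureDl m m' n : (m + m') ⊗ n = m ⊗ n + m' ⊗ n.
Proof. exact: raw_tpureDl. Qed.
Lemma tpureDr m n n' : m ⊗ (n + n') = m ⊗ n + m ⊗ n'.
Proof. exact: raw_tpureDr. Qed.
Lemma tpure_bal m a n : (m <* a) ⊗ n = m ⊗ (a *> n).
Proof. exact: raw_tpure_bal. Qed.
Lemma tpure_ract m n (b : B) : m ⊗ n <* b = m ⊗ (n <* b).
Proof. exact: raw_tlift_pure (tens_ract_bal b). Qed.

Lemma tens_sumE (x : tens) : x = \sum_(p <- repr (x : tens_sort)) p.1 ⊗ p.2.
Proof. exact: raw_tens_sumE. Qed.

Lemma tens_ind (P : tens -> Prop) :
  (forall m n, P (m ⊗ n)) -> (forall x y, P x -> P y -> P (x + y)) ->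
  forall x, P x.
Proof. exact: raw_tens_ind. Qed.

Lemma tens_ext (G : zmodType) (f g : tens -> G) :
  {morph f : x y / x + y} -> {morph g : x y / x + y} ->
  (forall m n, f (m ⊗ n) = g (m ⊗ n)) -> f =1 g.
Proof.
by move=> fD gD fg; apply: tens_ind => // x y; rewrite fD gD => -> ->.
Qed.

Lemma tlift_pure (G : zmodType) (f : M -> N -> G) m n :
  balanced f -> tlift f (m ⊗ n) = f m n.
Proof. exact: raw_tlift_pure. Qed.

Lemma tliftD (G : zmodType) (f : M -> N -> G) :
  balanced f -> {morph tlift f : x y / x + y}.
Proof. exact: raw_tliftD. Qed.

Lemma tlift_addf (G : zmodType) (f g : M -> N -> G) x :
  tlift (fun m n => f m n + g m n) x = tlift f x + tlift g x.
Proof. by rewrite /tlift /raw_tlift big_split. Qed.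

Lemma tlift_comp (G H : zmodType) (h : G -> H) (f : M -> N -> G) x :
  {morph h : x y / x + y} -> h (tlift f x) = tlift (fun m n => h (f m n)) x.
Proof. by move=> hD; rewrite /tlift /raw_tlift morphD_sum. Qed.

Lemma eq_tlift (G : zmodType) (f g : M -> N -> G) x :
  (forall m n, f m n = g m n) -> tlift f x = tlift g x.
Proof. by move=> fg; apply: eq_bigr => p _; apply: fg. Qed.

Lemma tlift_id x : tlift tpure x = x.
Proof. exact: esym (raw_tens_sumE x). Qed.

End TensorProduct.

Arguments tpure {A B M N} m n.
Notation "m ⊗ n" := (tpure m n) : ring_scope.

Section TensorBimodule.
Variables (A' A B : pzRingType) (M : bimodule A' A) (N : bimodule A B).

Definition tens_lact (a : A') (x : tens M N) : tens M N :=
  tlift (fun m n => (a *> m) ⊗ n) x.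

Fact tens_lact_bal a :
  balanced (fun (m : M) (n : N) => (a *> m) ⊗ n : tens M N).
Proof.
split=> *; rewrite ?lactDr ?tpureDl ?tpureDr //.
by rewrite lact_ract tpure_bal.
Qed.

Fact tens_lactP : is_lact tens_lact.
Proof.
have D b := tliftD (tens_lact_bal b).
have E m n b : tens_lact b (m ⊗ n) = (b *> m) ⊗ n.
  exact: tlift_pure (tens_lact_bal b).
split=> [x|a b x|a x y|a b x].
- by elim/tens_ind: x => [m n|x y]; rewrite ?E ?lact1 // /tens_lact D => -> ->.
- elim/tens_ind: x => [m n|x y]; first by rewrite !E lactA.
  by rewrite /tens_lact !D => -> ->.
- exact: D.
- elim/tens_ind: x => [m n|x y]; first by rewrite !E lactDl tpureDl.
  by rewrite /tens_lact !D => -> ->; rewrite addrACA.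
Qed.

Fact tens_lact_ract a (x : tens M N) b : tens_lact a (x <* b) = tens_lact a x <* b.
Proof.
have D := tliftD (tens_lact_bal a).
elim/tens_ind: x => [m n|x y]; last first.
  by rewrite ractDl /tens_lact !D ractDl => -> ->.
rewrite tpure_ract /tens_lact !(tlift_pure _ _ (tens_lact_bal a)).
by rewrite tpure_ract.
Qed.

Definition btens : bimodule A' B := Bimodule tens_lactP tens_lact_ract.

Lemma tpure_lact a (m : M) (n : N) :
  a *> (m ⊗ n : btens) = (a *> m) ⊗ n.
Proof. exact: tlift_pure (tens_lact_bal a). Qed.
End TensorBimodule.

Section TensorMap.
Variables (A B B' : pzRingType) (M M' : rmodule A).
Variables (N : bimodule A B) (N' : bimodule A B').

Definition tmap (f : M -> M') (g : N -> N') : tens M N -> tens M' N' :=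
  tlift (fun m n => f m ⊗ g n).

Lemma tmap_bal f g : rlin f -> llin g ->
  balanced (fun (m : M) (n : N) => f m ⊗ g n : tens M' N').
Proof.
case=> fD fa [gD ga]; split=> [m m' n|m n n'|m a n].
- by rewrite fD tpureDl.
- by rewrite gD tpureDr.
- by rewrite fa ga tpure_bal.
Qed.

Lemma tmap_pure f g m n : rlin f -> llin g -> tmap f g (m ⊗ n) = f m ⊗ g n.
Proof. by move=> fP gP; apply/tlift_pure/tmap_bal. Qed.

Lemma tmapD f g : rlin f -> llin g -> {morph tmap f g : x y / x + y}.
Proof. by move=> fP gP; apply/tliftD/tmap_bal. Qed.

End TensorMap.

Lemma rlin_id (A : pzRingType) (M : rmodule A) : rlin (@id M).
Proof. by []. Qed.
Lemma llin_id (A B : pzRingType) (M : bimodule A B) : llin (@id M).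
Proof. by []. Qed.
Lemma bilin_rlin (A B : pzRingType) (M N : bimodule A B) (f : M -> N) :
  bilin f -> rlin f.
Proof. by case. Qed.
Lemma bilin_llin (A B : pzRingType) (M N : bimodule A B) (f : M -> N) :
  bilin f -> llin f.
Proof. by case. Qed.
Lemma rlin_comp (A : pzRingType) (L M N : rmodule A) (g : M -> N) (f : L -> M) :
  rlin g -> rlin f -> rlin (g \o f).
Proof.
by case=> gD ga [fD fa]; split=> [x y|x a] /=; rewrite ?fD ?gD // fa ga.
Qed.

Lemma tmap_rlin (A B : pzRingType) (M M' : rmodule A) (N N' : bimodule A B)
    (f : M -> M') (g : N -> N') :
  rlin f -> bilin g -> rlin (tmap f g).
Proof.
move=> fP gP; have gl := bilin_llin gP; split; first exact: tmapD.
move=> x b; elim/tens_ind: x => [m n|x y]; last first.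
  by rewrite ractDl !(tmapD fP gl) ractDl => -> ->.
by rewrite tpure_ract !tmap_pure // tpure_ract; case: gP => _ _ ->.
Qed.

Section TensorAssoc.
Variables (A B C : pzRingType).
Variables (L : rmodule A) (M : bimodule A B) (N : bimodule B C).

Definition tassoc : tens (tens L M) N -> tens L (btens M N) :=
  tlift (fun (x : tens L M) n =>
    tlift (fun l m => l ⊗ (m ⊗ n : btens M N)) x).

Lemma tassoc_bal1 n :
  balanced (fun (l : L) (m : M) => l ⊗ (m ⊗ n : btens M N) : tens L (btens M N)).
Proof.
split=> *; rewrite ?tpureDl ?tpureDr // tpure_bal; congr (_ ⊗ _).
exact: tpure_lact.
Qed.

Lemma tassoc_bal : balanced (fun (x : tens L M) n =>
  tlift (fun l m => l ⊗ (m ⊗ n : btens M N)) x : tens L (btens M N)).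
Proof.
have E := fun l m n => tlift_pure l m (tassoc_bal1 n).
have D := fun n => tliftD (tassoc_bal1 n).
split=> [x y n|x n n'|x b n]; first exact: D.
- rewrite -tlift_addf; apply: eq_tlift => l m.
  by rewrite -tpureDr -tpureDr.
- elim/tens_ind: x => [l m|x y]; last by rewrite ractDl !D => -> ->.
  by rewrite tpure_ract !E tpure_bal.
Qed.

Lemma tassoc_pure l m n : tassoc (l ⊗ m ⊗ n) = l ⊗ (m ⊗ n : btens M N).
Proof. by rewrite /tassoc (tlift_pure _ _ tassoc_bal) (tlift_pure _ _ (tassoc_bal1 _)). Qed.
Lemma tassocD : {morph tassoc : x y / x + y}.
Proof. exact: tliftD tassoc_bal. Qed.

Definition tassocV : tens L (btens M N) -> tens (tens L M) N :=
  tlift (fun l (x : btens M N) =>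
    tlift (fun m n => (l ⊗ m : tens L M) ⊗ n) x).

Lemma tassocV_bal1 l : balanced (fun (m : M) (n : N) =>
  (l ⊗ m : tens L M) ⊗ n : tens (tens L M) N).
Proof.
split=> *; rewrite -?tpure_ract ?tpure_bal ?tpureDl ?tpureDr //.
by rewrite -tpureDl -tpureDr.
Qed.

Lemma tassocV_bal : balanced (fun l (x : btens M N) =>
  tlift (fun m n => (l ⊗ m : tens L M) ⊗ n) x : tens (tens L M) N).
Proof.
have E := fun l m n => tlift_pure m n (tassocV_bal1 l).
have D := fun n => tliftD (tassocV_bal1 n).
split=> [l l' x|l x y|l a x].
- rewrite -tlift_addf; apply: eq_tlift => m n.
  by rewrite -!tpureDl.
- exact: D.
- elim/tens_ind: x => [m n|x y]; last by rewrite lactDr !D => -> ->.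
  by rewrite tpure_lact !E tpure_bal.
Qed.

Lemma tassocV_pure l m n : tassocV (l ⊗ (m ⊗ n : btens M N)) = l ⊗ m ⊗ n.
Proof. by rewrite /tassocV (tlift_pure _ _ tassocV_bal) (tlift_pure _ _ (tassocV_bal1 _)). Qed.
Lemma tassocVD : {morph tassocV : x y / x + y}.
Proof. exact: tliftD tassocV_bal. Qed.

Lemma tassocK : cancel tassoc tassocV.
Proof.
move=> x; elim/tens_ind: x => [w n|x y]; last first.
  by rewrite tassocD tassocVD => -> ->.
elim/tens_ind: w => [l m|x y]; last first.
  by rewrite tpureDl tassocD tassocVD => -> ->.
by rewrite tassoc_pure tassocV_pure.
Qed.

Lemma tassocVK : cancel tassocV tassoc.
Proof.
move=> x; elim/tens_ind: x => [l w|x y]; last first.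
  by rewrite tassocVD tassocD => -> ->.
elim/tens_ind: w => [m n|x y]; last first.
  by rewrite tpureDr tassocVD tassocD => -> ->.
by rewrite tassocV_pure tassoc_pure.
Qed.
End TensorAssoc.

(* An A-balanced biadditive product, linear in its outer variables, is the
   same thing as an A-bilinear map T ⊗_A T -> T. *)
Record aring (A : pzRingType) := ARing {
  ar_ring :> pzRingType;
  ar_ract : ar_ring -> A -> ar_ring;
  ar_lact : A -> ar_ring -> ar_ring;
  ar_ractP : is_ract ar_ract;
  ar_lactP : is_lact ar_lact;
  ar_lact_ract : forall a t b, ar_lact a (ar_ract t b) = ar_ract (ar_lact a t) b;
  ar_mul_lact : forall a t u, ar_lact a (t * u) = ar_lact a t * u;
  ar_mul_ract : forall t u a, ar_ract (t * u) a = t * ar_ract u a;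
  ar_mul_bal : forall t a u, ar_ract t a * u = t * ar_lact a u;
  ar_unit : A -> ar_ring;
  ar_unitD : {morph ar_unit : a b / a + b};
  ar_unit_lact : forall a b, ar_unit (a * b) = ar_lact a (ar_unit b);
  ar_unit_ract : forall a b, ar_unit (a * b) = ar_ract (ar_unit a) b;
  ar_unit1 : ar_unit 1 = 1 }.

Arguments ar_unit {A} T : rename.

Definition ar_bim (A : pzRingType) (T : aring A) : bimodule A A :=
  @Bimodule A A (RModule (@ar_ractP A T)) _ (@ar_lactP A T) (@ar_lact_ract A T).

Definition is_aring_mor (A : pzRingType) (S T : aring A) (f : S -> T) :=
  [/\ @bilin A A (ar_bim S) (ar_bim T) f,
      {morph f : s t / s * t} &
      forall a, f (ar_unit S a) = ar_unit T a].

Section ARingTheory.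
Variables (A : pzRingType) (T : aring A).

Lemma ar_unitM : {morph ar_unit T : a b / a * b}.
Proof.
move=> a b; rewrite ar_unit_ract -[ar_unit T a in LHS]mulr1.
by rewrite ar_mul_ract -ar_unit1 -ar_unit_ract mul1r.
Qed.

Lemma ar_lactE (a : A) (t : T) : ar_lact a t = ar_unit T a * t.
Proof.
by rewrite -[t in LHS]mul1r ar_mul_lact -ar_unit1 -ar_unit_lact mulr1.
Qed.

Lemma ar_ractE (a : A) (t : T) : ar_ract t a = t * ar_unit T a.
Proof.
by rewrite -[t in LHS]mulr1 ar_mul_ract -ar_unit1 -ar_unit_ract mul1r.
Qed.

Fact ar_unit_zmod : zmod_morphism (ar_unit T).
Proof. by move=> a b; rewrite ar_unitD (morphDN (@ar_unitD A T)). Qed.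
Fact ar_unit_monoid : monoid_morphism (ar_unit T).
Proof. by split; [apply: ar_unit1 | apply: ar_unitM]. Qed.
HB.instance Definition _ :=
  GRing.isZmodMorphism.Build A T (ar_unit T) ar_unit_zmod.
HB.instance Definition _ :=
  GRing.isMonoidMorphism.Build A T (ar_unit T) ar_unit_monoid.

Definition aring_unit : {rmorphism A -> T} := ar_unit T.

(* A right T-module as a right A-module, through the unit A -> T. *)
Definition amod (M : rmodule T) : rmodule A := rres aring_unit M.
End ARingTheory.

Arguments amod {A T} M.

Section ARingRestriction.
Variables (A B : pzRingType) (f : {rmorphism A -> B}) (S : aring B).

Let bs : bimodule A A := bres f (ar_bim S).

Definition ares : aring A.
Proof.
refine (@ARing A S (@ract A bs) (@lact A A bs) (ractP bs) (lactP bs)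
  (@lact_ract A A bs) _ _ _ (fun a => ar_unit S (f a)) _ _ _ _).
- by move=> a t u; apply: ar_mul_lact.
- by move=> t u a; apply: ar_mul_ract.
- by move=> t a u; apply: ar_mul_bal.
- by move=> a b; rewrite rmorphD ar_unitD.
- by move=> a b; rewrite rmorphM ar_unit_lact.
- by move=> a b; rewrite rmorphM ar_unit_ract.
- by rewrite rmorph1 ar_unit1.
Defined.
End ARingRestriction.

(* [comulA] uses the associator (C ⊗ C) ⊗ C -> C ⊗ (C ⊗ C). *)
Record coring (A : pzRingType) := Coring {
  co_bim :> bimodule A A;
  comul : co_bim -> btens co_bim co_bim;
  counit : co_bim -> breg A;
  comul_bilin : bilin comul;
  counit_bilin : bilin counit;
  comulA : forall c, tassoc (tmap comul id (comul c)) = tmap id comul (comul c);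
  counit_comul : forall c, tlift (fun c1 c2 => counit c1 *> c2) (comul c) = c;
  comul_counit : forall c, tlift (fun c1 c2 => c1 <* counit c2) (comul c) = c }.

Arguments comul {A} C c : rename.
Arguments counit {A} C c : rename.

(* The canonical map D ⊗_A D -> D ⊗_B D, the source being formed through f. *)
Definition tens_canon (A B : pzRingType) (f : {rmorphism A -> B})
    (D : bimodule B B) : tens (bres f D) (bres f D) -> tens D D :=
  tlift (fun (d : bres f D) (d' : bres f D) => (d : D) ⊗ (d' : D)).

Definition is_coring_mor (A B : pzRingType) (f : {rmorphism A -> B})
    (C : coring A) (D : coring B) (theta : C -> D) :=
  [/\ @bilin A A C (bres f D) theta,
      forall c, tens_canon
          (tmap (M' := bres f D) (N' := bres f D) theta theta (comul C c))
        = comul D (theta c) &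
      forall c, counit D (theta c) = f (counit C c)].

Section LeftDual.
Variables (A : pzRingType) (C : coring A).

Record ldual := LDual {
  ldual_fun :> C -> breg A;
  ldual_llin : llin ldual_fun }.

HB.instance Definition _ := gen_eqMixin ldual.
HB.instance Definition _ := gen_choiceMixin ldual.

Lemma ldual_eq (f g : ldual) : f =1 g -> f = g.
Proof.
case: f g => f fP [g gP] /= /funext fg; move: gP; rewrite -fg => gP.
by rewrite (Prop_irrelevance fP gP).
Qed.

Lemma ldualD (f : ldual) : {morph f : x y / x + y}.
Proof. by case: (ldual_llin f). Qed.
Lemma ldualZ (f : ldual) a c : f (a *> c) = a * f c.
Proof. by case: (ldual_llin f). Qed.

Definition ldual_zero : ldual.
Proof.
exists (fun=> 0); split=> [x y|a x]; first by rewrite addr0.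
by rewrite lact0r.
Defined.
Definition ldual_add (f g : ldual) : ldual.
Proof.
exists (fun c => f c + g c).
by split=> [x y|a x]; rewrite ?ldualD ?ldualZ ?lactDr 1?addrACA.
Defined.
Definition ldual_opp (f : ldual) : ldual.
Proof.
exists (fun c => - f c).
by split=> [x y|a x]; rewrite ?ldualD ?ldualZ ?opprD //= mulrN.
Defined.

Fact ldual_addA : associative ldual_add.
Proof. by move=> f g h; apply: ldual_eq => c /=; rewrite addrA. Qed.
Fact ldual_addC : commutative ldual_add.
Proof. by move=> f g; apply: ldual_eq => c /=; rewrite addrC. Qed.
Fact ldual_add0 : left_id ldual_zero ldual_add.
Proof. by move=> f; apply: ldual_eq => c /=; rewrite add0r. Qed.
Fact ldual_addN : left_inverse ldual_zero ldual_opp ldual_add.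
Proof. by move=> f; apply: ldual_eq => c /=; rewrite addNr. Qed.
HB.instance Definition _ := GRing.isZmodule.Build ldual
  ldual_addA ldual_addC ldual_add0 ldual_addN.

(* (f * g)(c) = \sum g (c_1 f(c_2)) *)
Definition star (f g : C -> breg A) (c : C) : breg A :=
  tlift (fun c1 c2 => g (c1 <* f c2)) (comul C c).

Lemma star_bal (f g : ldual) :
  balanced (fun c1 c2 : C => g (c1 <* f c2) : breg A).
Proof.
by split=> *; rewrite ?ractDl ?ldualD ?ractDr ?ldualD ?ldualZ // ractA.
Qed.

Lemma comulD : {morph comul C : x y / x + y}.
Proof. by case: (comul_bilin C). Qed.
Lemma comul_lact a c : comul C (a *> c) = a *> comul C c.
Proof. by case: (comul_bilin C). Qed.
Lemma comul_ract a c : comul C (c <* a) = comul C c <* a.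
Proof. by case: (comul_bilin C). Qed.

Fact star_llin (f g : ldual) : llin (star f g).
Proof.
have D := tliftD (star_bal f g).
split=> [x y|a c]; rewrite /star; first by rewrite comulD D.
rewrite comul_lact; elim/tens_ind: (comul C c) => [c1 c2|x y]; last first.
  by rewrite lactDr !D lactDr => -> ->.
rewrite tpure_lact !(tlift_pure _ _ (star_bal f g)).
by rewrite -lact_ract ldualZ.
Qed.

Definition ldual_mul (f g : ldual) : ldual := LDual (star_llin f g).
Definition ldual_one : ldual := LDual (bilin_llin (counit_bilin C)).

Lemma star_ract (f g : ldual) c a :
  star f g (c <* a) = tlift (fun c1 c2 => g (c1 <* f (c2 <* a))) (comul C c).
Proof.
have bal : balanced (fun c1 c2 : C => g (c1 <* f (c2 <* a)) : breg A).
  by split=> *; rewrite ?ractDl ?ldualD ?ractDr ?ldualD // -lact_ract ldualZ ractA.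
rewrite /star comul_ract; elim/tens_ind: (comul C c) => [c1 c2|x y]; last first.
  by rewrite ractDl !(tliftD bal) !(tliftD (star_bal f g)) => -> ->.
by rewrite tpure_ract (tlift_pure _ _ bal) (tlift_pure _ _ (star_bal f g)).
Qed.

Fact ldual_mulA : associative ldual_mul.
Proof.
move=> f g h; apply: ldual_eq => c /=.
pose K (z : btens C (btens C C)) : breg A := tlift (fun c1 (w : btens C C) =>
  h (c1 <* tlift (fun c2 c3 => g (c2 <* f c3) : breg A) w)) z.
have Kb : balanced (fun c1 (w : btens C C) =>
    h (c1 <* tlift (fun c2 c3 => g (c2 <* f c3) : breg A) w) : breg A).
  split=> [x y w|x w w'|x a w].
  - by rewrite ractDl ldualD.
  - by rewrite (tliftD (star_bal f g)) ractDr ldualD.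
  - congr (h _); rewrite -ractA; congr (_ <* _).
    elim/tens_ind: w => [c2 c3|w w']; last first.
      by rewrite lactDr !(tliftD (star_bal f g)) mulrDr => -> ->.
    by rewrite tpure_lact !(tlift_pure _ _ (star_bal f g)) -lact_ract ldualZ.
have KD : {morph K : x y / x + y} := tliftD Kb.
have KE c1 w : K (c1 ⊗ w) = h (c1 <* tlift (fun c2 c3 => g (c2 <* f c3)) w).
  exact: tlift_pure Kb.
transitivity (K (tassoc (tmap (comul C) id (comul C c)))); last first.
  rewrite comulA /star.
  elim/tens_ind: (comul C c) => [c1 c2|x y]; last first.
    rewrite (tmapD (@rlin_id _ _) (bilin_llin (comul_bilin C))) KD => -> ->.
    by rewrite (tliftD (star_bal (ldual_mul f g) h)).
  rewrite (tmap_pure _ _ (@rlin_id _ _) (bilin_llin (comul_bilin C))).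
  by rewrite KE (tlift_pure _ _ (star_bal (ldual_mul f g) h)).
rewrite /star.
elim/tens_ind: (comul C c) => [c1 c2|x y]; last first.
  rewrite (tmapD (bilin_rlin (comul_bilin C)) (@llin_id _ _ _)) tassocD KD => <- <-.
  by rewrite (tliftD (star_bal f (ldual_mul g h))).
rewrite (tmap_pure _ _ (bilin_rlin (comul_bilin C)) (@llin_id _ _ _)).
rewrite (tlift_pure _ _ (star_bal f (ldual_mul g h))) /=.
rewrite star_ract.
have bal : balanced (fun x y : C => h (x <* g (y <* f c2)) : breg A).
  by split=> *; rewrite ?ractDl ?ldualD ?ractDr ?ldualD // -lact_ract ldualZ ractA.
elim/tens_ind: (comul C c1) => [x y|x y]; last first.
  by rewrite (tliftD bal) tpureDl tassocD KD => -> ->.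
rewrite (tlift_pure _ _ bal) tassoc_pure KE.
by rewrite (tlift_pure _ _ (star_bal f g)).
Qed.

Fact ldual_mul1 : left_id ldual_one ldual_mul.
Proof.
move=> f; apply: ldual_eq => c /=; rewrite -[RHS](congr1 f (comul_counit c)).
by rewrite (tlift_comp _ _ (@ldualD f)).
Qed.
Fact ldual_mulr1 : right_id ldual_one ldual_mul.
Proof.
move=> f; apply: ldual_eq => c /=; rewrite -[RHS](congr1 f (counit_comul c)).
rewrite (tlift_comp _ _ (@ldualD f)); apply: eq_tlift => c1 c2.
by rewrite ldualZ; case: (counit_bilin C).
Qed.
Fact ldual_mulDl : left_distributive ldual_mul +%R.
Proof.
move=> f g h; apply: ldual_eq => c /=.
rewrite /star -tlift_addf; apply: eq_tlift => c1 c2 /=.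
by rewrite ractDr ldualD.
Qed.
Fact ldual_mulDr : right_distributive ldual_mul +%R.
Proof.
by move=> f g h; apply: ldual_eq => c /=; rewrite /star -tlift_addf.
Qed.

HB.instance Definition _ := GRing.Zmodule_isPzRing.Build ldual
  ldual_mulA ldual_mul1 ldual_mulr1 ldual_mulDl ldual_mulDr.

(* The A-bimodule structure: (a f)(c) = f (c a) and (f a)(c) = f(c) a. *)
Definition ldual_lact (a : A) (f : ldual) : ldual.
Proof.
exists (fun c => f (c <* a)).
by split=> [x y|b x]; rewrite ?ractDl ?ldualD // -lact_ract ldualZ.
Defined.
Definition ldual_ract (f : ldual) (a : A) : ldual.
Proof.
exists (fun c => (f c : breg A) <* a).
by split=> [x y|b x]; rewrite ?ldualD ?ractDl // ldualZ lact_ract.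
Defined.
(* c |-> ε(c) a = ε(c a) *)
Definition ldual_unit (a : A) : ldual := ldual_ract ldual_one a.

Lemma counitZ c a : counit C (c <* a) = counit C c * a.
Proof. by case: (counit_bilin C). Qed.

Definition coring_ldual : aring A.
Proof.
refine (@ARing A ldual ldual_ract ldual_lact _ _ _ _ _ _ ldual_unit _ _ _ _).
- by split=> *; apply: ldual_eq => c /=; rewrite ?mulr1 ?mulrA ?mulrDl ?mulrDr.
- split=> *; apply: ldual_eq => c /=;
    by rewrite ?ract1 ?ractA ?ractDl ?ractDr ?ldualD.
- by move=> *; apply: ldual_eq.
- move=> a f g; apply: ldual_eq => c /=; rewrite star_ract.
  by apply: eq_tlift.
- move=> f g a; apply: ldual_eq => c /=; rewrite /star.
  rewrite (@tlift_comp _ _ _ _ _ _ (fun x : A => x * a)) //.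
  by move=> x y; rewrite mulrDl.
- move=> f a g; apply: ldual_eq => c /=; rewrite /star; apply: eq_tlift => c1 c2.
  by rewrite /= -ractA.
- by move=> a b; apply: ldual_eq => c /=; rewrite mulrDr.
- by move=> a b; apply: ldual_eq => c /=; rewrite counitZ mulrA.
- by move=> a b; apply: ldual_eq => c /=; rewrite mulrA.
- by apply: ldual_eq => c /=; rewrite mulr1.
Defined.
End LeftDual.

Record category := Category {
  obj :> Type;
  hom : obj -> obj -> Type;
  idc : forall X, hom X X;
  comp : forall X Y Z, hom Y Z -> hom X Y -> hom X Z;
  comp1f : forall X Y (f : hom X Y), comp (idc Y) f = f;
  compf1 : forall X Y (f : hom X Y), comp f (idc X) = f;
  compA : forall X Y Z W (h : hom Z W) (g : hom Y Z) (f : hom X Y),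
    comp h (comp g f) = comp (comp h g) f }.

Arguments idc {c} X.
Arguments comp {c X Y Z} g f.

Record functor (C D : category) := Functor {
  fobj :> C -> D;
  fmap : forall X Y, hom X Y -> hom (fobj X) (fobj Y);
  fmap1 : forall X, fmap (idc X) = idc (fobj X);
  fmapM : forall X Y Z (g : hom Y Z) (f : hom X Y),
    fmap (comp g f) = comp (fmap g) (fmap f) }.

Arguments fmap {C D} F {X Y} f : rename.

Definition functor_comp (C D E : category) (G : functor D E) (F : functor C D) :
  functor C E.
Proof.
exists (fun X => G (F X)) (fun X Y f => fmap G (fmap F f)) => [X|X Y Z g f].
- by rewrite !fmap1.
- by rewrite !fmapM.
Defined.

(* (F, G) is an adjoint pair: F is left adjoint to G, i.e. there are bijections
   Hom(F X, Y) -> Hom(X, G Y) natural in X and Y. *)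
Definition adjoint_pair (C D : category) (F : functor C D) (G : functor D C) :=
  exists phi : forall (X : C) (Y : D), hom (F X) Y -> hom X (G Y),
    [/\ forall X Y, bijective (@phi X Y),
        forall X' X Y (u : hom X' X) (f : hom (F X) Y),
          phi X' Y (comp f (fmap F u)) = comp (phi X Y f) u &
        forall X Y Y' (v : hom Y Y') (f : hom (F X) Y),
          phi X Y' (comp v f) = comp (fmap G v) (phi X Y f)].

Record rhom (A : pzRingType) (M N : rmodule A) := RHom {
  rhom_fun :> M -> N;
  rhomP : rlin rhom_fun }.

Lemma rhom_eq (A : pzRingType) (M N : rmodule A) (f g : rhom M N) :
  f =1 g -> f = g.
Proof.
case: f g => f fP [g gP] /= /funext fg; move: gP; rewrite -fg => gP.
by rewrite (Prop_irrelevance fP gP).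
Qed.

Lemma rhomD (A : pzRingType) (M N : rmodule A) (f : rhom M N) :
  {morph f : x y / x + y}.
Proof. by case: (rhomP f). Qed.
Lemma rhomZ (A : pzRingType) (M N : rmodule A) (f : rhom M N) x a :
  f (x <* a) = f x <* a.
Proof. by case: (rhomP f). Qed.

Definition RMod (A : pzRingType) : category.
Proof.
refine (@Category (rmodule A) (@rhom A) (fun M => RHom (@rlin_id A M))
  (fun L M N g f => RHom (rlin_comp (rhomP g) (rhomP f))) _ _ _).
- by move=> *; apply: rhom_eq.
- by move=> *; apply: rhom_eq.
- by move=> *; apply: rhom_eq.
Defined.

(* Hom_{-S}(X, N), a right T-module by (f t)(x) = f (t x) when X is a
   (T, S)-bimodule. *)
Section HomModule.
Variables (T S : pzRingType) (X : bimodule T S) (N : rmodule S).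

HB.instance Definition _ := gen_eqMixin (rhom X N).
HB.instance Definition _ := gen_choiceMixin (rhom X N).

Definition rhom_zero : rhom X N.
Proof.
exists (fun=> 0); split=> [x y|x a]; first by rewrite addr0.
by rewrite ract0l.
Defined.
Definition rhom_add (f g : rhom X N) : rhom X N.
Proof.
exists (fun x => f x + g x).
by split=> [x y|x a]; rewrite ?rhomD ?rhomZ ?ractDl // addrACA.
Defined.
Definition rhom_opp (f : rhom X N) : rhom X N.
Proof.
exists (fun x => - f x); split=> [x y|x a]; first by rewrite rhomD opprD.
by rewrite rhomZ (@morphDN _ _ (fun y : N => y <* a)) // => y z; apply: ractDl.
Defined.
Fact rhom_addA : associative rhom_add.
Proof. by move=> f g h; apply: rhom_eq => c /=; rewrite addrA. Qed.
Fact rhom_addC : commutative rhom_add.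
Proof. by move=> f g; apply: rhom_eq => c /=; rewrite addrC. Qed.
Fact rhom_add0 : left_id rhom_zero rhom_add.
Proof. by move=> f; apply: rhom_eq => c /=; rewrite add0r. Qed.
Fact rhom_addN : left_inverse rhom_zero rhom_opp rhom_add.
Proof. by move=> f; apply: rhom_eq => c /=; rewrite addNr. Qed.
HB.instance Definition _ := GRing.isZmodule.Build (rhom X N)
  rhom_addA rhom_addC rhom_add0 rhom_addN.

Definition rhom_ract (f : rhom X N) (t : T) : rhom X N.
Proof.
exists (fun x => f (t *> x)).
by split=> [x y|x a]; rewrite ?lactDr ?rhomD // lact_ract rhomZ.
Defined.

Fact rhom_ractP : is_ract rhom_ract.
Proof.
by split=> *; apply: rhom_eq => x /=; rewrite ?lact1 ?lactA ?lactDl ?rhomD.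
Qed.

Definition hom_mod : rmodule T := RModule rhom_ractP.
End HomModule.

Definition hom_mod_map (T S : pzRingType) (X : bimodule T S) (N N' : rmodule S)
    (u : rhom N N') : rhom (hom_mod X N) (hom_mod X N').
Proof.
exists (fun f : rhom X N => RHom (rlin_comp (rhomP u) (rhomP f)) : rhom X N').
split=> [f g|f t]; last exact: (@rhom_eq S X N').
by apply: (@rhom_eq S X N') => x /=; rewrite rhomD.
Defined.

Definition Hom_functor (T S : pzRingType) (X : bimodule T S) :
  functor (RMod S) (RMod T).
Proof.
refine (@Functor (RMod S) (RMod T) (hom_mod X) (@hom_mod_map T S X) _ _).
- move=> N; apply: (@rhom_eq T (hom_mod X N) (hom_mod X N)) => f.
  exact: rhom_eq.
- move=> L M N g f; apply: (@rhom_eq T (hom_mod X L) (hom_mod X N)) => h.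
  exact: rhom_eq.
Defined.

Section Comodules.
Variables (A : pzRingType) (C : coring A).

Record comodule := Comodule {
  cm_mod :> rmodule A;
  coact : cm_mod -> tens cm_mod C;
  coact_rlin : rlin coact;
  coactA : forall m,
    tassoc (tmap coact id (coact m)) = tmap id (comul C) (coact m);
  coact_counit : forall m, tlift (fun n c => n <* counit C c) (coact m) = m }.

Record chom (M N : comodule) := CHom {
  chom_fun :> rhom M N;
  chom_colin : forall m, coact (chom_fun m) = tmap chom_fun id (coact m) }.

Lemma chom_eq (M N : comodule) (f g : chom M N) : f =1 g -> f = g.
Proof.
case: f g => f fP [g gP] /= /rhom_eq fg; move: gP; rewrite -fg => gP.
by congr CHom; apply: Prop_irrelevance.
Qed.

Lemma coactD (M : comodule) : {morph @coact M : x y / x + y}.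
Proof. by case: (coact_rlin M). Qed.
Lemma coactZ (M : comodule) m a : coact (m <* a : M) = coact m <* a.
Proof. by case: (coact_rlin M). Qed.

Lemma tmap_id (M : rmodule A) (x : tens M C) : tmap id id x = x.
Proof. exact: tlift_id. Qed.

Lemma tmap_comp (L M N : rmodule A) (g : M -> N) (f : L -> M) (x : tens L C) :
  rlin f -> rlin g ->
  tmap (N' := C) (g \o f) id x = tmap g id (tmap (N' := C) f id x).
Proof.
move=> fP gP; have gfP := rlin_comp gP fP; have idP := @llin_id _ _ C.
elim/tens_ind: x => [m n|x y]; first by rewrite !tmap_pure.
by rewrite !tmapD // => -> ->.
Qed.

Definition chom_id (M : comodule) : chom M M.
Proof. by exists (RHom (@rlin_id A M)) => m; rewrite [RHS]tmap_id. Defined.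

Definition chom_comp (L M N : comodule) (g : chom M N) (f : chom L M) : chom L N.
Proof.
exists (RHom (rlin_comp (rhomP g) (rhomP f))) => m /=.
by rewrite tmap_comp ?chom_colin //; apply: rhomP.
Defined.

Definition Comod : category.
Proof.
refine (@Category comodule chom chom_id chom_comp _ _ _).
- by move=> *; apply: chom_eq.
- by move=> *; apply: chom_eq.
- by move=> *; apply: chom_eq.
Defined.
End Comodules.

Record measuring_pairing (A : pzRingType) := MeasuringPairing {
  mp_ring : aring A;
  mp_coring : coring A;
  mp_kappa : mp_ring -> coring_ldual mp_coring;
  mp_kappaP : is_aring_mor mp_kappa }.

Definition pairing (A : pzRingType) (P : measuring_pairing A)
    (t : mp_ring P) (c : mp_coring P) : A :=
  (mp_kappa t : ldual (mp_coring P)) c.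

(* alpha_M : M ⊗_A C -> Hom_{-A}(T, M) *)
Definition alpha (A : pzRingType) (P : measuring_pairing A) (M : rmodule A)
    (x : tens M (mp_coring P)) (t : mp_ring P) : M :=
  tlift (fun m c => m <* pairing t c) x.

Definition is_alpha_pairing (A : pzRingType) (P : measuring_pairing A) :=
  forall M : rmodule A, injective (@alpha A P M).

Definition is_pairing_mor (A B : pzRingType) (f : {rmorphism A -> B})
    (P : measuring_pairing A) (Q : measuring_pairing B)
    (xi : mp_ring Q -> mp_ring P) (theta : mp_coring P -> mp_coring Q) :=
  [/\ is_coring_mor f theta,
      @is_aring_mor A (ares f (mp_ring Q)) (mp_ring P) xi &
      forall s c, pairing s (theta c) = f (pairing (xi s) c)].

Section PairingTheory.
Variables (A : pzRingType) (P : measuring_pairing A).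
Local Notation T := (mp_ring P).
Local Notation C := (mp_coring P).
Implicit Types (t u : T) (c : C) (a : A).

Lemma pairingDl t u c : pairing (t + u) c = pairing t c + pairing u c.
Proof. by rewrite /pairing; case: (mp_kappaP P) => [[-> _ _] _ _]. Qed.
Lemma pairing_lact a t c :
  pairing (ar_lact a t) c = pairing t (c <* a).
Proof.
by rewrite /pairing; case: (mp_kappaP P) => [[_ H _] _ _]; rewrite [mp_kappa _]H.
Qed.
Lemma pairing_ract a t c : pairing (ar_ract t a) c = pairing t c * a.
Proof.
by rewrite /pairing; case: (mp_kappaP P) => [[_ _ H] _ _]; rewrite [mp_kappa _]H.
Qed.
Lemma pairingM t u c :
  pairing (t * u) c =
  tlift (fun c1 c2 => pairing u (c1 <* pairing t c2)) (comul C c).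
Proof. by rewrite /pairing; case: (mp_kappaP P) => [_ -> _]. Qed.
Lemma pairing_unit a c : pairing (ar_unit T a) c = counit C c * a.
Proof. by rewrite /pairing; case: (mp_kappaP P) => [_ _ ->]. Qed.
Lemma pairing1 c : pairing (1 : T) c = counit C c.
Proof. by rewrite -ar_unit1 pairing_unit mulr1. Qed.
Lemma pairingDr t c d : pairing t (c + d) = pairing t c + pairing t d.
Proof. exact: ldualD. Qed.
Lemma pairingZ t a c : pairing t (a *> c) = a * pairing t c.
Proof. exact: ldualZ. Qed.

Variable M : rmodule A.
Implicit Types x y : tens M C.

Lemma alpha_bal t : balanced (fun (m : M) (c : C) => m <* pairing t c).
Proof.
by split=> *; rewrite ?ractDl ?pairingDr ?ractDr // pairingZ ractA.
Qed.
Lemma alpha_pure t (m : M) (c : C) : alpha (m ⊗ c) t = m <* pairing t c.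
Proof. exact: tlift_pure (alpha_bal t). Qed.
Lemma alphaDl t x y : alpha (x + y) t = alpha x t + alpha y t.
Proof. exact: tliftD (alpha_bal t) x y. Qed.
Lemma alphaDr t u x : alpha x (t + u) = alpha x t + alpha x u.
Proof.
rewrite -tlift_addf; apply: eq_tlift => m c.
by rewrite pairingDl ractDr.
Qed.
Lemma alpha_ract x a t : alpha (x <* a) t = alpha x (ar_lact a t).
Proof.
elim/tens_ind: x => [m c|x y]; last by rewrite ractDl !alphaDl => -> ->.
by rewrite tpure_ract !alpha_pure pairing_lact.
Qed.
Lemma alpha_ar_ract x a t : alpha x (ar_ract t a) = alpha x t <* a.
Proof.
elim/tens_ind: x => [m c|x y]; last by rewrite !alphaDl ractDl => -> ->.
by rewrite !alpha_pure pairing_ract ractA.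
Qed.
Lemma alpha1 x : alpha x (1 : T) = tlift (fun m c => m <* counit C c) x.
Proof. by apply: eq_tlift => m c; rewrite pairing1. Qed.

End PairingTheory.

Section PairingModules.
Variables (A : pzRingType) (P : measuring_pairing A).
Local Notation T := (mp_ring P).
Local Notation C := (mp_coring P).

Lemma alpha_nat (M N : rmodule A) (f : M -> N) (x : tens M C) (t : T) :
  rlin f -> f (alpha x t) = alpha (tmap (N' := C) f id x) t.
Proof.
move=> fP; have [fD fa] := fP.
elim/tens_ind: x => [m c|x y].
  by rewrite (tmap_pure _ _ fP (@llin_id _ _ C)) !alpha_pure fa.
by rewrite (tmapD fP (@llin_id _ _ C)) !alphaDl fD => -> ->.
Qed.

Lemma alphaM (M : rmodule A) (x : tens M C) (t u : T) :
  alpha x (t * u) = alpha (alpha (tassocV (tmap id (comul C) x)) t) u.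
Proof.
have cl := bilin_llin (comul_bilin C); have il := @rlin_id _ M.
elim/tens_ind: x => [m c|x y]; last first.
  by rewrite (tmapD il cl) tassocVD !alphaDl => -> ->.
rewrite (tmap_pure _ _ il cl) alpha_pure pairingM.
have bal : balanced (fun c1 c2 : C => pairing u (c1 <* pairing t c2) : breg A).
  exact: star_bal (mp_kappa t) (mp_kappa u).
elim/tens_ind: (comul C c) => [c1 c2|x y]; last first.
  by rewrite (tliftD bal) ractDr tpureDr tassocVD !alphaDl => -> ->.
by rewrite (tlift_pure _ _ bal) tassocV_pure alpha_pure tpure_ract alpha_pure.
Qed.

(* The T-action on a comodule: n t = \sum n_<0> <t, n_<1>>. *)
Section ComoduleAction.
Variable N : comodule C.

Definition com_ract (n : N) (t : T) : N := alpha (coact n) t.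

Fact com_ractP : is_ract com_ract.
Proof.
have cP := coact_rlin N.
split=> [n|n t u|m n t|n t u]; rewrite /com_ract.
- by rewrite alpha1 coact_counit.
- rewrite alphaM -coactA tassocK.
  by rewrite (alpha_nat _ _ cP).
- by rewrite coactD alphaDl.
- exact: alphaDr.
Qed.

Definition com_mod : rmodule T := RModule com_ractP.
End ComoduleAction.

Definition com_mod_map (M N : comodule C) (f : chom M N) :
  rhom (com_mod M) (com_mod N).
Proof.
exists (chom_fun f : com_mod M -> com_mod N).
split=> [|m t]; first by case: (rhomP f).
change (f (alpha (coact m) t) = alpha (coact (f m)) t).
by rewrite chom_colin; apply: alpha_nat; apply: rhomP.
Defined.

Definition com_embedding : functor (Comod C) (RMod T).
Proof.
refine (@Functor (Comod C) (RMod T) com_mod com_mod_map _ _).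
- by move=> M; apply: (@rhom_eq T (com_mod M) (com_mod M)).
- by move=> L M N g f; apply: (@rhom_eq T (com_mod L) (com_mod N)).
Defined.
End PairingModules.

Section QuotientModule.
Variables (A : pzRingType) (M : rmodule A) (S : M -> Prop).
Hypothesis S0 : S 0.
Hypothesis SB : forall x y, S x -> S y -> S (x - y).
Hypothesis Sa : forall x a, S x -> S (x <* a).

Let SN x : S x -> S (- x). Proof. by move=> Sx; rewrite -sub0r; apply: SB. Qed.
Let SD x y : S x -> S y -> S (x + y).
Proof. by move=> Sx Sy; rewrite -[y]opprK; apply/SB/SN. Qed.

Definition qm_rel (x y : M) : bool := `[< S (x - y) >].
Fact qm_rel_refl : reflexive qm_rel.
Proof. by move=> x; apply/asboolP; rewrite subrr. Qed.
Fact qm_rel_sym : symmetric qm_rel.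
Proof.
by move=> x y; apply/asboolP/asboolP => /SN; rewrite opprB.
Qed.
Fact qm_rel_trans : transitive qm_rel.
Proof.
move=> y x z /asboolP xy /asboolP yz; apply/asboolP.
by rewrite -(subrKA y); apply: SD.
Qed.
Canonical qm_equiv := EquivRel qm_rel qm_rel_refl qm_rel_sym qm_rel_trans.
Definition qm_sort := {eq_quot qm_equiv}.
HB.instance Definition _ := Choice.on qm_sort.

Definition qm_pi (x : M) : qm_sort := \pi_qm_sort x.
Lemma qm_piP x y : qm_pi x = qm_pi y <-> S (x - y).
Proof.
split=> [/eqP|H]; first by rewrite eqmodE => /asboolP.
by apply/eqP; rewrite eqmodE; apply/asboolP.
Qed.
Lemma qm_repr x : qm_pi (repr x) = x. Proof. exact: reprK. Qed.
Lemma qm_reprS x : S (repr (qm_pi x) - x).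
Proof. by apply/qm_piP; rewrite qm_repr. Qed.

Definition qm_add (x y : qm_sort) := qm_pi (repr x + repr y).
Definition qm_opp (x : qm_sort) := qm_pi (- repr x).
Definition qm_ract (x : qm_sort) a := qm_pi (repr x <* a).
Lemma qm_add_pi x y : qm_add (qm_pi x) (qm_pi y) = qm_pi (x + y).
Proof. by apply/qm_piP; rewrite opprD addrACA; apply: SD; apply: qm_reprS. Qed.
Lemma qm_ract_pi x a : qm_ract (qm_pi x) a = qm_pi (x <* a).
Proof.
apply/qm_piP.
have <- : (repr (qm_pi x) - x) <* a = repr (qm_pi x) <* a - x <* a.
  rewrite ractDl (@morphDN _ _ (fun y : M => y <* a)) // => y z.
  exact: ractDl.
by apply: Sa; apply: qm_reprS.
Qed.
Lemma qm_ind (K : qm_sort -> Prop) : (forall x, K (qm_pi x)) -> forall x, K x.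
Proof. by move=> H x; rewrite -(qm_repr x). Qed.

Fact qm_addA : associative qm_add.
Proof.
elim/qm_ind=> x; elim/qm_ind=> y; elim/qm_ind=> z.
by rewrite !qm_add_pi addrA.
Qed.
Fact qm_addC : commutative qm_add.
Proof. by elim/qm_ind=> x; elim/qm_ind=> y; rewrite !qm_add_pi addrC. Qed.
Fact qm_add0 : left_id (qm_pi 0) qm_add.
Proof. by elim/qm_ind=> x; rewrite qm_add_pi add0r. Qed.
Fact qm_addN : left_inverse (qm_pi 0) qm_opp qm_add.
Proof.
move=> x; rewrite -{2}(qm_repr x) /qm_opp qm_add_pi addNr //.
Qed.
HB.instance Definition _ := GRing.isZmodule.Build qm_sort
  qm_addA qm_addC qm_add0 qm_addN.

Fact qm_ractP : is_ract qm_ract.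
Proof.
split; elim/qm_ind=> x.
- by rewrite qm_ract_pi ract1.
- by move=> a b; rewrite !qm_ract_pi ractA.
- elim/qm_ind=> y a; rewrite [_ + _]qm_add_pi !qm_ract_pi ractDl.
  by rewrite [RHS]qm_add_pi.
- by move=> a b; rewrite !qm_ract_pi ractDr [RHS]qm_add_pi.
Qed.
Definition qm : rmodule A := RModule qm_ractP.

Lemma qm_pi_rlin : rlin (qm_pi : M -> qm).
Proof.
split=> [x y|x a]; first by rewrite [RHS]qm_add_pi.
by rewrite [RHS]qm_ract_pi.
Qed.

(* Exactness of S ⊗ N -> M ⊗ N -> (M / S) ⊗ N -> 0 in the middle. *)
Variables (B : pzRingType) (N : bimodule A B).

Inductive in_sub : tens M N -> Prop :=
| InSubPure m n : S m -> in_sub (m ⊗ n)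
| InSubD x y : in_sub x -> in_sub y -> in_sub (x + y).

Lemma tpure0l n : (0 : M) ⊗ n = 0 :> tens M N.
Proof. by apply: (@morphD0 _ _ (fun m : M => m ⊗ n)) => x y; apply: tpureDl. Qed.
Lemma tpureNl (m : M) n : (- m) ⊗ n = - (m ⊗ n) :> tens M N.
Proof. by apply: (@morphDN _ _ (fun m : M => m ⊗ n)) => x y; apply: tpureDl. Qed.

Lemma in_sub0 : in_sub 0.
Proof. by rewrite -(tpure0l 0); apply: InSubPure. Qed.
Lemma in_subN x : in_sub x -> in_sub (- x).
Proof.
elim=> [m n Sm|{}x y _ IHx _ IHy]; first by rewrite -tpureNl; apply/InSubPure/SN.
by rewrite opprD; apply: InSubD.
Qed.

Let lift (s : seq (qm * N)) : tens M N := \sum_(p <- s) repr p.1 ⊗ p.2.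

Lemma lift_rel s t : tens_rel s t -> in_sub (lift s - lift t).
Proof.
have S1 m m' n : S (m - m') -> in_sub (m ⊗ n - m' ⊗ n).
  by move=> H; rewrite -tpureNl -tpureDl; apply: InSubPure.
rewrite /lift; elim=> {s t}.
- by move=> s; rewrite subrr; apply: in_sub0.
- by move=> s t _ /in_subN; rewrite opprB.
- by move=> s t u _ st _ tu; rewrite -(subrKA (lift t)); apply: InSubD.
- move=> s s' t t' _ H _ H'; rewrite !big_cat /= opprD addrACA.
  exact: InSubD.
- by move=> s t; rewrite !big_cat /= [X in _ - X]addrC subrr; apply: in_sub0.
- move=> n; rewrite big_nil big_seq1 subr0 /=; apply: InSubPure.
  by rewrite -[repr _]subr0; apply/qm_piP; rewrite qm_repr.
- move=> m m' n; rewrite big_seq1 big_cons big_seq1 /= -tpureDl; apply: S1.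
  apply/qm_piP; rewrite qm_repr.
  by rewrite -[m in LHS]qm_repr -[m' in LHS]qm_repr [LHS]qm_add_pi.
- move=> m n n'; rewrite big_seq1 big_cons big_seq1 /= tpureDr subrr.
  exact: in_sub0.
- move=> m a n; rewrite !big_seq1 /= -tpure_bal; apply: S1.
  by apply/qm_piP; rewrite qm_repr.
Qed.

Lemma tens_qm_exact (x : tens M N) :
  tmap (M' := qm) (N' := N) qm_pi id x = 0 -> in_sub x.
Proof.
move=> x0; pose r : seq (M * N) := repr (x : tens_sort M N).
have xE : x = \sum_(p <- r) p.1 ⊗ p.2 := tens_sumE x.
have: tens_rel [seq (qm_pi p.1 : qm, p.2) | p <- r] [::].
  apply/tens_ofP; rewrite tens_of_sum big_map.
  exact: x0.
move=> /lift_rel; rewrite {2}/lift big_nil subr0 /lift big_map => H.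
have {}H : in_sub (\sum_(p <- r) repr (qm_pi p.1) ⊗ p.2) by [].
rewrite xE -[X in in_sub X](subKr (\sum_(p <- r) repr (qm_pi p.1) ⊗ p.2)).
apply: InSubD => //; apply: in_subN; rewrite -sumrB.
elim: r {xE H} => [|[m n] r IHr]; first by rewrite big_nil; apply: in_sub0.
rewrite big_cons; apply: InSubD => //=.
by rewrite -tpureNl -tpureDl; apply/InSubPure/qm_reprS.
Qed.
End QuotientModule.

Section Rational.
Variables (A : pzRingType) (P : measuring_pairing A).
Hypothesis alphaP : is_alpha_pairing P.
Local Notation T := (mp_ring P).
Local Notation C := (mp_coring P).

Section RatModule.
Variable M : rmodule T.

(* m t = \sum m_i <t, c_i> for all t, with x = \sum m_i ⊗ c_i *)
Definition is_rat (m : M) :=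
  exists x : tens (amod M) C, forall t : T, m <* t = alpha x t.

Record rat := Rat { rat_val :> M; rat_is_rat : is_rat rat_val }.

HB.instance Definition _ := gen_eqMixin rat.
HB.instance Definition _ := gen_choiceMixin rat.

Lemma rat_inj : injective rat_val.
Proof.
case=> m mP [n nP] /= mn; move: nP; rewrite -mn => nP.
by rewrite (Prop_irrelevance mP nP).
Qed.

Lemma is_rat0 : is_rat 0.
Proof.
exists 0 => t; rewrite ract0l.
by rewrite (@morphD0 _ _ (fun x : tens (amod M) C => alpha x t)) // => x y;
   rewrite alphaDl.
Qed.
Lemma is_ratN m : is_rat m -> is_rat (- m).
Proof.
case=> x xP; exists (- x) => t.
rewrite (@morphDN _ _ (fun x : tens (amod M) C => alpha x t)); last first.
  by move=> y z; rewrite alphaDl.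
rewrite -xP (@morphDN _ _ (fun m : M => m <* t)) // => y z.
exact: ractDl.
Qed.
Lemma is_ratD m n : is_rat m -> is_rat n -> is_rat (m + n).
Proof.
move=> [x xP] [y yP]; exists (x + y) => t.
by rewrite ractDl xP yP alphaDl.
Qed.
Lemma is_rat_ract m a : is_rat m -> is_rat ((m : amod M) <* a).
Proof.
case=> x xP; exists (x <* a) => t.
by rewrite alpha_ract -xP ar_lactE -ractA.
Qed.
Lemma is_rat_ractT m (t : T) : is_rat m -> is_rat (m <* t).
Proof.
case=> x xP; exists (alpha (tassocV (tmap id (comul C) x)) t) => u.
by rewrite -ractA xP alphaM.
Qed.

Definition rat_add (m n : rat) : rat :=
  Rat (is_ratD (rat_is_rat m) (rat_is_rat n)).
Definition rat_opp (m : rat) : rat := Rat (is_ratN (rat_is_rat m)).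
Definition rat_ract (m : rat) a : rat := Rat (is_rat_ract a (rat_is_rat m)).
Definition rat_ractT (m : rat) t : rat := Rat (is_rat_ractT t (rat_is_rat m)).

Fact rat_addA : associative rat_add.
Proof. by move=> f g h; apply: rat_inj; rewrite /= addrA. Qed.
Fact rat_addC : commutative rat_add.
Proof. by move=> f g; apply: rat_inj; rewrite /= addrC. Qed.
Fact rat_add0 : left_id (Rat is_rat0) rat_add.
Proof. by move=> f; apply: rat_inj; rewrite /= add0r. Qed.
Fact rat_addN : left_inverse (Rat is_rat0) rat_opp rat_add.
Proof. by move=> f; apply: rat_inj; rewrite /= addNr. Qed.
HB.instance Definition _ := GRing.isZmodule.Build rat
  rat_addA rat_addC rat_add0 rat_addN.

Fact rat_ractP : is_ract rat_ract.
Proof.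
split=> *; apply: rat_inj.
- exact: (@ract1 _ (amod M)).
- exact: (@ractA _ (amod M)).
- exact: (@ractDl _ (amod M)).
- exact: (@ractDr _ (amod M)).
Qed.
Definition rat_mod : rmodule A := RModule rat_ractP.

Lemma rat_val_rlin : rlin (rat_val : rat_mod -> amod M).
Proof. by []. Qed.

Lemma rat_witness (m : rat_mod) :
  exists x : tens rat_mod C, forall t : T, alpha x t = rat_ractT m t.
Proof.
have [x xP] := rat_is_rat m.
have Sa y a : is_rat y -> is_rat ((y : amod M) <* a) by apply: is_rat_ract.
have SB y z : is_rat y -> is_rat z -> is_rat (y - z).
  by move=> ry rz; apply: is_ratD => //; apply: is_ratN.
pose S : amod M -> Prop := is_rat.
have piP := qm_pi_rlin (is_rat0 : S 0) SB Sa.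
have: in_sub S x.
  apply: (tens_qm_exact (S0 := is_rat0 : S 0) (SB := SB) (Sa := Sa)).
  apply: alphaP; apply: funext => t.
  rewrite -(alpha_nat _ _ piP) -xP.
  have -> : alpha (0 : tens (qm (is_rat0 : S 0) SB Sa) C) t = 0.
    apply: (@morphD0 _ _ (fun x : tens (qm (is_rat0 : S 0) SB Sa) C => alpha x t)).
    by move=> y z; apply: alphaDl.
  apply/qm_piP; rewrite subr0.
  by apply: is_rat_ractT; apply: rat_is_rat.
have vP := rat_val_rlin; have idP := @llin_id _ _ C.
have lift : in_sub S x ->
    exists y : tens rat_mod C, tmap (N' := C) (rat_val : rat_mod -> amod M) id y = x.
  elim=> [n c Sn|y z _ [y' <-] _ [z' <-]].
    by exists ((Rat Sn : rat_mod) ⊗ c); rewrite tmap_pure.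
  by exists (y' + z'); rewrite tmapD.
move=> /lift [y yx].
exists y => t; apply: rat_inj; rewrite /= xP.
by rewrite (alpha_nat (N := amod M) _ _ vP) yx.
Qed.

(* The coaction m |-> \sum m_i ⊗ c_i, viewed in Rat(M) ⊗_A C; it is determined
   by its characterization [alpha_rat_coact]. *)
Definition rat_coact (m : rat_mod) : tens rat_mod C :=
  projT1 (cid (rat_witness m)).

Lemma alpha_rat_coact m t : alpha (rat_coact m) t = rat_ractT m t.
Proof. by rewrite /rat_coact; case: cid. Qed.

Lemma rat_coactE (m : rat_mod) (x : tens (amod M) C) :
  (forall t, rat_val m <* t = alpha x t) ->
  tmap (M := rat_mod) (M' := amod M) (N' := C) rat_val id (rat_coact m) = x.
Proof.
move=> xP; apply: alphaP; apply: funext => t.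
by rewrite -(alpha_nat _ _ rat_val_rlin) alpha_rat_coact -xP.
Qed.

Fact rat_coact_rlin : rlin rat_coact.
Proof.
split=> [m n|m a]; apply: alphaP; apply: funext => t.
  rewrite alphaDl !alpha_rat_coact; apply: rat_inj; exact: ractDl.
rewrite alpha_ract !alpha_rat_coact; apply: rat_inj.
by rewrite /= -ractA -ar_lactE.
Qed.

Fact rat_coactA m :
  tassoc (tmap rat_coact id (rat_coact m)) = tmap id (comul C) (rat_coact m).
Proof.
apply: (can_inj (@tassocVK _ _ _ rat_mod C C)); rewrite tassocK.
apply: alphaP; apply: funext => t; apply: alphaP; apply: funext => u.
rewrite -alphaM -(alpha_nat _ _ rat_coact_rlin) !alpha_rat_coact.
by apply: rat_inj; rewrite /= ractA.
Qed.

Fact rat_coact_counit m :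
  tlift (fun n c => n <* counit C c) (rat_coact m) = m.
Proof. by rewrite -alpha1 alpha_rat_coact; apply: rat_inj; rewrite /= ract1. Qed.

Definition rat_comod : comodule C :=
  Comodule rat_coact_rlin rat_coactA rat_coact_counit.
End RatModule.

Section RatMap.
Variables (M N : rmodule T) (f : rhom M N).

Lemma is_rat_map m : is_rat m -> is_rat (f m).
Proof.
case=> x xP; exists (tmap (M := amod M) (M' := amod N) (N' := C) f id x) => t.
rewrite -rhomZ xP; apply: (@alpha_nat _ _ (amod M) (amod N)).
by split=> [|y a]; [apply: (rhomD f) | apply: (rhomZ f)].
Qed.

Definition rat_map_fun (m : rat M) : rat N := Rat (is_rat_map (rat_is_rat m)).

Fact rat_map_rlin : rlin (rat_map_fun : rat_mod M -> rat_mod N).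
Proof.
by split=> [x y|x a]; apply: rat_inj; [apply: (rhomD f) | apply: (rhomZ f)].
Qed.

Definition rat_map : chom (rat_comod M) (rat_comod N).
Proof.
exists (RHom rat_map_rlin) => m.
apply: (@alphaP (rat_mod N)); apply: funext => t.
rewrite -(alpha_nat _ _ rat_map_rlin) !alpha_rat_coact.
by apply: rat_inj; rewrite /= rhomZ.
Defined.
End RatMap.

Definition Rat_functor : functor (RMod T) (Comod C).
Proof.
refine (@Functor (RMod T) (Comod C) rat_comod rat_map _ _).
- by move=> M; apply: (@chom_eq _ _ (rat_comod M) (rat_comod M)) => m; apply: rat_inj.
- move=> L M N g f; apply: (@chom_eq _ _ (rat_comod L) (rat_comod N)) => m.
  exact: rat_inj.
Defined.
End Rational.

Definition balg (A B : pzRingType) (f : {rmorphism A -> B}) : bimodule A B :=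
  lres f (breg B).

Section Induction.
Variables (A B : pzRingType) (f : {rmorphism A -> B}).
Variables (C : coring A) (D : coring B) (theta : C -> D).
Hypothesis thetaP : is_coring_mor f theta.

Let thetaD : {morph theta : x y / x + y}. Proof. by case: thetaP => [[]]. Qed.
Let theta_lact a c : theta (a *> c) = f a *> theta c.
Proof. by case: thetaP => [[]]. Qed.
Let theta_ract c a : theta (c <* a) = theta c <* f a.
Proof. by case: thetaP => [[]]. Qed.

Section IndComodule.
Variable M : comodule C.

Definition ind_mod : rmodule B := tens M (balg f).

Local Notation "m ⊗1" := (@tpure A B M (balg f) m (1 : B) : ind_mod)
  (at level 40).

(* M ⊗_A D ≃ (M ⊗_A B) ⊗_B D *)
Definition ind_iso : tens M (lres f D) -> tens ind_mod D :=
  tlift (fun (m : M) (d : lres f D) => (m ⊗1) ⊗ (d : D)).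

Lemma ind_iso_bal :
  balanced (fun (m : M) (d : lres f D) => (m ⊗1) ⊗ (d : D)).
Proof.
split=> [m m' d|m d d'|m a d]; rewrite ?tpureDl ?tpureDr //.
rewrite tpure_bal -[RHS]tpure_bal tpure_ract; congr (_ ⊗ _ ⊗ _).
by rewrite /= mul1r mulr1.
Qed.
Lemma ind_isoD : {morph ind_iso : x y / x + y}.
Proof. exact: tliftD ind_iso_bal. Qed.
Lemma ind_iso_pure m (d : D) :
  ind_iso (m ⊗ (d : lres f D)) = (m ⊗1) ⊗ d.
Proof. exact: tlift_pure ind_iso_bal. Qed.

(* m ⊗ b |-> \sum m_<0> ⊗ theta(m_<1>) b *)
Definition ind_coact : ind_mod -> tens ind_mod D :=
  tlift (fun m (b : balg f) =>
    ind_iso (tmap (N' := lres f D) id (fun c => theta c <* b) (coact m))).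

Lemma theta_llin b : @llin A A B C (lres f D) (fun c => theta c <* b).
Proof.
split=> [c d|a c]; first by rewrite thetaD ractDl.
by rewrite theta_lact lact_ract.
Qed.

Let tmD b := tmapD (N' := lres f D) (@rlin_id _ M) (theta_llin b).
Let tmE b m c := tmap_pure (N' := lres f D) m c (@rlin_id _ M) (theta_llin b).

Lemma ind_coact_bal : balanced (fun (m : M) (b : balg f) =>
  ind_iso (tmap (N' := lres f D) id (fun c => theta c <* b) (coact m))).
Proof.
split=> [m m' b|m b b'|m a b].
- by rewrite coactD tmD ind_isoD.
- rewrite -ind_isoD; congr ind_iso; rewrite /tmap -tlift_addf.
  by apply: eq_tlift => n c; rewrite -tpureDr ractDr.
- congr ind_iso; rewrite coactZ.
  elim/tens_ind: (coact m) => [n c|x y]; last by rewrite ractDl !tmD => -> ->.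
  by rewrite tpure_ract !tmE theta_ract -ractA.
Qed.

Lemma ind_coact_pure (m : M) (b : balg f) : ind_coact (m ⊗ b) =
  ind_iso (tmap (N' := lres f D) id (fun c => theta c <* b) (coact m)).
Proof. exact: tlift_pure ind_coact_bal. Qed.
Lemma ind_coactD : {morph ind_coact : x y / x + y}.
Proof. exact: tliftD ind_coact_bal. Qed.

Fact ind_coact_rlin : rlin ind_coact.
Proof.
split; first exact: ind_coactD.
move=> x b; elim/tens_ind: x => [m b'|x y]; last first.
  by rewrite ractDl !ind_coactD ractDl => -> ->.
rewrite tpure_ract !ind_coact_pure.
elim/tens_ind: (coact m) => [n c|x y]; last first.
  by rewrite !tmD !ind_isoD ractDl => -> ->.
by rewrite !tmE !ind_iso_pure tpure_ract ractA.
Qed.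

Let thth (z : btens C C) : tens D D :=
  tens_canon (tmap (M' := bres f D) (N' := bres f D) theta theta z).

Let theta_rlin : @rlin A C (bres f D) theta. Proof. by []. Qed.
Let theta_llin' : @llin A A A C (bres f D) theta. Proof. by []. Qed.

Lemma canon_bal : balanced (fun (d : bres f D) (d' : bres f D) =>
  (d : D) ⊗ (d' : D)).
Proof. by split=> *; rewrite ?tpureDl ?tpureDr ?tpure_bal. Qed.

Let ththD : {morph thth : x y / x + y}.
Proof.
by move=> x y; rewrite /thth (tmapD theta_rlin theta_llin') [LHS](tliftD canon_bal).
Qed.
Let thth_pure c d : thth (c ⊗ d) = theta c ⊗ theta d.
Proof.
by rewrite /thth (tmap_pure _ _ theta_rlin theta_llin') [LHS](tlift_pure _ _ canon_bal).
Qed.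

Let Psi b (z : tens M (btens C C)) : tens ind_mod (btens D D) :=
  tlift (fun m (w : btens C C) =>
    (m ⊗1) ⊗ (thth w <* b : btens D D)) z.

Let Psi_bal b : balanced (fun (m : M) (w : btens C C) =>
    (m ⊗1) ⊗ (thth w <* b : btens D D)).
Proof.
split=> [m m' w|m w w'|m a w].
- by rewrite !tpureDl.
- by rewrite ththD ractDl tpureDr.
- have -> : (m <* a) ⊗1 = (m ⊗1) <* f a.
    by rewrite tpure_ract tpure_bal; congr (_ ⊗ _); rewrite /= mul1r mulr1.
  rewrite tpure_bal; congr (_ ⊗ _).
  rewrite [LHS](@lact_ract _ _ (btens D D)); congr (_ <* _).
  elim/tens_ind: w => [c d|x y]; last first.
    rewrite lactDr !ththD => <- <-.
    exact: (@lactDr _ _ (btens D D)).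
  by rewrite tpure_lact !thth_pure [LHS](@tpure_lact _ _ _ D D) theta_lact.
Qed.

Fact ind_coactA x : tassoc (tmap ind_coact id (ind_coact x)) =
  tmap id (comul D) (ind_coact x).
Proof.
have cl := bilin_llin (comul_bilin D); have il := @rlin_id _ ind_mod.
have cl' := bilin_llin (comul_bilin C); have il' := @rlin_id _ M.
have ir := @llin_id _ _ D; have ir' := @llin_id _ _ C.
have cr := coact_rlin M; have icr := ind_coact_rlin.
elim/tens_ind: x => [m b|x y]; last first.
  by rewrite ind_coactD (tmapD icr ir) tassocD (tmapD il cl) => -> ->.
rewrite ind_coact_pure.
have PsiD : {morph Psi b : y z / y + z} := tliftD (Psi_bal b).
have PsiE n w : Psi b (n ⊗ w) = (n ⊗1) ⊗ (thth w <* b : btens D D).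
  exact: tlift_pure (Psi_bal b).
transitivity (Psi b (tassoc (tmap (@coact _ _ M) id (coact m)))).
  elim/tens_ind: (coact m) => [n c|x y]; last first.
    rewrite tmD ind_isoD (tmapD icr ir) tassocD (tmapD cr ir') tassocD.
    by rewrite PsiD => -> ->.
  rewrite tmE ind_iso_pure (tmap_pure _ _ icr ir) (tmap_pure _ _ cr ir').
  rewrite ind_coact_pure; elim/tens_ind: (coact n) => [n' c'|x y]; last first.
    by rewrite tmD ind_isoD !tpureDl !tassocD PsiD => -> ->.
  rewrite tmE ind_iso_pure !tassoc_pure PsiE thth_pure ract1.
  by rewrite tpure_ract.
rewrite coactA.
elim/tens_ind: (coact m) => [n c|x y]; last first.
  rewrite tmD ind_isoD (tmapD il cl) (tmapD il' cl').
  by rewrite PsiD => -> ->.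
rewrite tmE ind_iso_pure (tmap_pure _ _ il cl) (tmap_pure _ _ il' cl') PsiE.
congr (_ ⊗ _); rewrite comul_ract; congr (_ <* _).
by case: thetaP => _ H _; apply: H.
Qed.

Fact ind_coact_counit x :
  tlift (fun y d => y <* counit D d) (ind_coact x) = x.
Proof.
have bal : balanced (fun (y : ind_mod) (d : D) => y <* counit D d).
  have [eD el er] := counit_bilin D.
  by split=> *; rewrite ?ractDl ?eD ?ractDr // el ractA.
elim/tens_ind: x => [m b|x y]; last first.
  by rewrite ind_coactD (tliftD bal) => -> ->.
rewrite ind_coact_pure -[in RHS](coact_counit m).
have bal' : balanced (fun (n : M) (c : C) => n <* counit C c).
  have [eD el er] := counit_bilin C.
  by split=> *; rewrite ?ractDl ?eD ?ractDr // el ractA.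
elim/tens_ind: (coact m) => [n c|x y]; last first.
  by rewrite tmD ind_isoD (tliftD bal) (tliftD bal') tpureDl => -> ->.
rewrite tmE ind_iso_pure (tlift_pure _ _ bal) (tlift_pure _ _ bal').
rewrite tpure_ract tpure_bal; congr (_ ⊗ _); rewrite /= mul1r.
rewrite counitZ; congr (_ * _).
by case: thetaP => _ _ ->.
Qed.

Definition ind_comod : comodule D :=
  Comodule ind_coact_rlin ind_coactA ind_coact_counit.
End IndComodule.

Section IndMap.
Variables (M N : comodule C) (g : chom M N).
Let gP := rhomP g.

Fact ind_map_rlin : @rlin B (ind_mod M) (ind_mod N) (tmap g id).
Proof. by apply: tmap_rlin. Qed.

Definition ind_map : chom (ind_comod M) (ind_comod N).
Proof.
exists (RHom ind_map_rlin) => x /=.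
have iB := @llin_id _ _ (balg f); have iD := @llin_id _ _ D.
have mr := ind_map_rlin; have iC := @llin_id _ _ C.
have D1 := tmapD gP iB; have E1 m b := tmap_pure m b gP iB.
have D2 := tmapD mr iD; have E2 m b := tmap_pure m b mr iD.
elim/tens_ind: x => [m b|x y]; last first.
  by rewrite D1 !ind_coactD D2 => -> ->.
rewrite E1 !ind_coact_pure chom_colin.
elim/tens_ind: (coact m) => [n c|x y]; last first.
  rewrite (tmapD gP iC) !(tmapD (N' := lres f D) (@rlin_id _ _) (theta_llin b)).
  by rewrite !ind_isoD D2 => -> ->.
rewrite (tmap_pure _ _ gP iC).
rewrite !(tmap_pure (N' := lres f D) _ _ (@rlin_id _ _) (theta_llin b)).
by rewrite !ind_iso_pure E2 E1.
Defined.
End IndMap.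

Definition Ind_functor : functor (Comod C) (Comod D).
Proof.
refine (@Functor (Comod C) (Comod D) ind_comod ind_map _ _).
- move=> M; apply: (@chom_eq _ _ (ind_comod M) (ind_comod M)) => x.
  exact: tlift_id.
- move=> L M N g h; apply: (@chom_eq _ _ (ind_comod L) (ind_comod N)) => x /=.
  have iB := @llin_id _ _ (balg f).
  have gP := rhomP g; have hP := rhomP h; have ghP := rlin_comp gP hP.
  elim/tens_ind: x => [m b|x y]; first by rewrite /= !tmap_pure.
  by rewrite /= !tmapD // => -> ->.
Defined.
End Induction.

Section TensorTB.
Variables (A B : pzRingType) (f : {rmorphism A -> B}).
Variables (T : aring A) (S : aring B) (xi : S -> T).

Definition TB : rmodule B := tens (ar_bim T) (balg f).

(* The right S-module structure (t ⊗ b) s = t xi(s) ⊗ b.  For noncommutative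
   rings this formula need not be compatible with the relations
   (t a) ⊗ b = t ⊗ f(a) b, so the structure is given as data. *)
Record TB_structure := TBStructure {
  TB_ract : TB -> S -> TB;
  TB_ractP : is_ract TB_ract;
  TB_ractE : forall (t : ar_bim T) (b : balg f) s,
    TB_ract (t ⊗ b) s = ((t : T) * xi s : ar_bim T) ⊗ b }.

Definition ar_bimTA : bimodule T A :=
  @Bimodule T A (ar_bim T) (fun t u => t * u) (reg_lactP T)
    (fun t u a => esym (ar_mul_ract t u a)).

Variable X : TB_structure.

Definition TB_lact (t : T) (x : TB) : TB :=
  (t *> (x : btens ar_bimTA (balg f))).

Fact TB_lact_ract t (x : TB) s :
  TB_lact t (TB_ract X x s) = TB_ract X (TB_lact t x) s.
Proof.
have [_ _ D _] := TB_ractP X.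
elim/tens_ind: x => [u b|x y]; last first.
  by rewrite D /TB_lact !lactDr D => -> ->.
rewrite TB_ractE /TB_lact.
rewrite [LHS](@tpure_lact _ _ _ ar_bimTA (balg f)).
rewrite [in RHS](@tpure_lact _ _ _ ar_bimTA (balg f)).
by rewrite TB_ractE; congr (_ ⊗ _); apply: mulrA.
Qed.

Definition TB_bim : bimodule T S :=
  @Bimodule T S (RModule (TB_ractP X)) TB_lact
    (lactP (btens ar_bimTA (balg f))) TB_lact_ract.
End TensorTB.

Lemma pairing_mor_coring (A B : pzRingType) (f : {rmorphism A -> B})
    (P : measuring_pairing A) (Q : measuring_pairing B)
    (xi : mp_ring Q -> mp_ring P) (theta : mp_coring P -> mp_coring Q) :
  is_pairing_mor f xi theta -> is_coring_mor f theta.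
Proof. by case. Qed.

(* Main.v *)
(** The point is that the formula [(t ⊗ b) s = t ξ(s) ⊗ b] also describes the
    S-action on [M ⊗_A B] that comes from its D-coaction, although the latter
    gives [(m ⊗ b) s = m ξ(b s) ⊗ 1].  Taking [s = 1] yields
    [m ξ(b) ⊗ 1 = m ⊗ b]; since the S-module structure on [T ⊗_A B] exists, the
    map [m ⊗ b |-> m ξ(s) ⊗ b] is well defined on [M ⊗_A B], and applying it to
    this identity gives [m ξ(b) ξ(s) ⊗ 1 = m ξ(s) ⊗ b].  The adjunction is then
    the tensor-hom bijection [f |-> (m |-> (t ⊗ b |-> f (m t ⊗ b)))], because by
    the α-condition colinear maps are exactly the linear maps for the
    actions of the rings [T] and [S]. *)
Require Import Defs.
From HB Require Import structures.
From mathcomp Require Import all_boot all_order all_algebra.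
From mathcomp Require Import boolp.

Set Implicit Arguments.
Unset Strict Implicit.
Unset Printing Implicit Defensive.

Import GRing.Theory.
Local Open Scope ring_scope.

(** * Comodules as modules over the ring of a pairing *)

Section ComoduleAction.
Variables (A : pzRingType) (P : measuring_pairing A).
Local Notation T := (mp_ring P).
Local Notation C := (mp_coring P).

Section Action.
Variable M : comodule C.
Implicit Types (m n : M) (t u : T) (a : A).

Lemma com_ract1 m : com_ract m (1 : T) = m.
Proof. exact: (@ract1 _ (com_mod M)). Qed.
Lemma com_ractM m t u : com_ract m (t * u) = com_ract (com_ract m t) u.
Proof. exact: (@ractA _ (com_mod M)). Qed.
Lemma com_ractDl m n t : com_ract (m + n) t = com_ract m t + com_ract n t.
Proof. exact: (@ractDl _ (com_mod M)). Qed.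
Lemma com_ractDr m t u : com_ract m (t + u) = com_ract m t + com_ract m u.
Proof. exact: (@ractDr _ (com_mod M)). Qed.
Lemma com_ract_ar_ract m t a : com_ract m (ar_ract t a) = com_ract m t <* a.
Proof. exact: alpha_ar_ract. Qed.
Lemma com_ract_lact m a t : com_ract (m <* a : M) t = com_ract m (ar_lact a t).
Proof. by rewrite /com_ract coactZ alpha_ract. Qed.
(** Recovers the A-action from the T-action, so that T-linear maps are A-linear. *)
Lemma com_ract_unit m a : com_ract m (ar_unit T a) = m <* a.
Proof. by rewrite -[ar_unit T a]mul1r -ar_ractE com_ract_ar_ract com_ract1. Qed.
End Action.

Lemma chom_com_ract (M N : comodule C) (f : chom M N) (m : M) (t : T) :
  f (com_ract m t) = com_ract (f m) t.
Proof. exact: (rhomZ (com_mod_map f)). Qed.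

Hypothesis alphaP : is_alpha_pairing P.

Section ColinearOfLinear.
Variables (M N : comodule C) (f : M -> N).
Hypotheses (fD : {morph f : x y / x + y})
  (fZ : forall (m : M) (t : T), f (com_ract m t) = com_ract (f m) t).

Fact com_rlin : rlin f.
Proof. by split=> // m a; rewrite -!com_ract_unit fZ. Qed.

(** By injectivity of [alpha] it suffices to compare both sides at each [t]; naturality of [alpha]
    then reduces the claim to T-linearity of [f]. *)
Fact com_colin (m : M) : coact (f m) = tmap f id (coact m).
Proof.
apply: alphaP; apply: funext => t; rewrite -(alpha_nat _ _ com_rlin).
by rewrite -[LHS]/(com_ract (f m) t) -fZ.
Qed.

Definition chom_of_linear : chom M N := @CHom _ _ M N (RHom com_rlin) com_colin.
End ColinearOfLinear.

Section RatLift.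
Variables (M : comodule C) (H : rmodule T) (g : rhom (com_mod M) H).

Lemma com_rhom_amod_rlin : @rlin A M (amod H) g.
Proof.
split=> [|m a]; first exact: (rhomD g).
by rewrite -com_ract_unit; apply: (rhomZ g m).
Qed.

Lemma com_rhom_is_rat (m : M) : is_rat (g m : H).
Proof.
(* The coaction of [m], pushed forward along [g], witnesses rationality. *)
exists (tmap (M' := amod H) (N' := C) g id (coact m)) => t.
by rewrite -(alpha_nat _ _ com_rhom_amod_rlin) -rhomZ.
Qed.

Lemma com_ract_rat (x : rat_comod alphaP H) t : com_ract x t = rat_ractT x t.
Proof. exact: alpha_rat_coact. Qed.

Definition rat_lift_fun (m : M) : rat_comod alphaP H := Defs.Rat (com_rhom_is_rat m).

Fact rat_lift_funD : {morph rat_lift_fun : m n / m + n}.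
Proof. by move=> m n; apply: rat_inj; apply: (rhomD g). Qed.

Fact rat_lift_funZ (m : M) (t : T) :
  rat_lift_fun (com_ract m t) = com_ract (rat_lift_fun m) t.
Proof. by apply: rat_inj; rewrite com_ract_rat; apply: (rhomZ g m t). Qed.

(** One half of the universal property of the rational part: a T-linear map out of a comodule
    corestricts to a colinear one. *)
Definition rat_lift : chom M (rat_comod alphaP H) :=
  chom_of_linear rat_lift_funD rat_lift_funZ.
End RatLift.
End ComoduleAction.

Section Adjunction.
Variables (A B : pzRingType) (beta : {rmorphism A -> B}).
Variables (P : measuring_pairing A) (Q : measuring_pairing B).
Hypotheses (alphaP : is_alpha_pairing P) (alphaQ : is_alpha_pairing Q).
Variables (xi : mp_ring Q -> mp_ring P) (theta : mp_coring P -> mp_coring Q).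
Hypothesis morP : is_pairing_mor beta xi theta.
Variable X : TB_structure beta xi.
Local Notation T := (mp_ring P).
Local Notation C := (mp_coring P).
Local Notation S := (mp_ring Q).
Local Notation D := (mp_coring Q).
Local Notation ind := (ind_comod (pairing_mor_coring morP)).

Let xiM : {morph xi : s u / s * u}. Proof. by case: morP => _ []. Qed.

(** * The S-action on an induced comodule *)

Section InducedAction.
Variable M : comodule C.
Implicit Types (m : M) (s : S) (t : T) (b : balg beta).

Let ir := @rlin_id A M.
Let tl b := theta_llin (pairing_mor_coring morP) b.

(** Since [⟨s, θ(c) b⟩ = ⟨b s, θ(c)⟩ = β(⟨ξ(b s), c⟩)], the scalar produced by the coaction comes
    from [A] and crosses the tensor sign. *)
Lemma ind_com_ract_xi m b s : com_ract (m ⊗ b : ind M) s =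
  (com_ract m (xi (ar_lact (b : B) s)) ⊗ (1 : balg beta)) :> ind M.
Proof.
have [_ _ pairing_xi] := morP.
rewrite /com_ract [coact _](ind_coact_pure (pairing_mor_coring morP)).
elim/tens_ind: (coact m) => [n c|x y]; last first.
  rewrite (tmapD (N' := lres beta D) ir (tl b)) ind_isoD !alphaDl tpureDl.
  by move=> -> ->.
rewrite (tmap_pure (N' := lres beta D) _ _ ir (tl b)) ind_iso_pure.
rewrite [LHS]alpha_pure alpha_pure tpure_bal tpure_ract; congr (_ ⊗ _).
by rewrite -pairing_lact pairing_xi /= mul1r mulr1.
Qed.

Lemma com_ract_xi_tpure1 m (b : B) :
  (com_ract m (xi (ar_unit S b)) ⊗ (1 : balg beta)) =
  m ⊗ (b : balg beta) :> ind M.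
Proof.
have := ind_com_ract_xi m b 1; rewrite com_ract1 => ->.
by rewrite ar_lactE mulr1.
Qed.

(** The orbit map [t ↦ m t] tensored with [B]; it carries identities from [T ⊗ B], where the
    S-action is given, over to [M ⊗ B]. *)
Definition TB_ind m : TB beta T -> ind_mod beta M :=
  tlift (fun (t : ar_bim T) b => com_ract m t ⊗ b).

Lemma TB_ind_bal m :
  balanced (fun (t : ar_bim T) b => com_ract m t ⊗ b : ind_mod beta M).
Proof.
split=> [t u b|t b b'|t a b]; first by rewrite com_ractDr tpureDl.
  by rewrite tpureDr.
by rewrite -tpure_bal -com_ract_ar_ract.
Qed.
Lemma TB_ind_pure m (t : ar_bim T) b : TB_ind m (t ⊗ b) = com_ract m t ⊗ b.
Proof. exact: tlift_pure (TB_ind_bal m). Qed.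
Lemma TB_indD m : {morph TB_ind m : x y / x + y}.
Proof. exact: tliftD (TB_ind_bal m). Qed.

(** With [a] read in [T], acting by [s] on [a ⊗ b = 1 ⊗ β(a) b] gives [a ξ(s) ⊗ b = ξ(s) ⊗ β(a) b],
    and [TB_ind m] maps this to the balancing identity. *)
Lemma ind_xi_bal s :
  balanced (fun m b => com_ract m (xi s) ⊗ b : ind_mod beta M).
Proof.
split=> [m n b|m b b'|m a b]; first by rewrite com_ractDl tpureDl.
  by rewrite tpureDr.
rewrite com_ract_lact ar_lactE -TB_ind_pure -(TB_ractE X).
rewrite -[ar_unit T a]mul1r -ar_ractE [Y in TB_ract _ Y _]tpure_bal.
by rewrite TB_ractE mul1r TB_ind_pure.
Qed.

Lemma ind_com_ract m b s :
  com_ract (m ⊗ b : ind M) s = (com_ract m (xi s) ⊗ b) :> ind M.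
Proof.
rewrite ind_com_ract_xi ar_lactE xiM com_ractM.
(* View [m ξ(b) ξ(s) ⊗ 1] as the image of [m ξ(b) ⊗ 1 = m ⊗ b] under the map just shown to be
   balanced. *)
rewrite -(tlift_pure _ _ (ind_xi_bal s)) com_ract_xi_tpure1.
exact: tlift_pure (ind_xi_bal s).
Qed.

Lemma TB_ind_ract m x s :
  TB_ind m (TB_ract X x s) = com_ract (TB_ind m x : ind M) s.
Proof.
have [_ _ D _] := TB_ractP X.
elim/tens_ind: x => [t b|x y]; last first.
  by rewrite D !TB_indD com_ractDl => -> ->.
by rewrite TB_ractE !TB_ind_pure com_ractM ind_com_ract.
Qed.

Lemma TB_ind_lact m (t : T) x :
  TB_ind (com_ract m t) x = TB_ind m (TB_lact t x).
Proof.
elim/tens_ind: x => [u b|x y].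
  rewrite [TB_lact _ _](@tpure_lact _ _ _ (ar_bimTA T) (balg beta)).
  by rewrite !TB_ind_pure -com_ractM.
rewrite [TB_lact t (x + y)](@lactDr _ _ (btens (ar_bimTA T) (balg beta))).
by rewrite !TB_indD => -> ->.
Qed.

Lemma TB_indDl m n x : TB_ind (m + n) x = TB_ind m x + TB_ind n x.
Proof.
by rewrite /TB_ind -tlift_addf; apply: eq_tlift => t b; rewrite com_ractDl tpureDl.
Qed.
End InducedAction.

Local Notation HomTB N := (hom_mod (TB_bim X) (com_mod N)).
Local Notation CoindTB N := (rat_comod alphaP (HomTB N)).

(** * The tensor-hom bijection for colinear maps *)

Section Bijection.
Variables (M : comodule C) (N : comodule D).

Section ToCoind.
Variable f : chom (ind M) N.

Definition to_hom (m : M) : HomTB N.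
Proof.
exists (fun x : TB_bim X => f (TB_ind m x) : com_mod N).
split=> [x y|x s]; first by rewrite TB_indD (rhomD f).
by rewrite TB_ind_ract chom_com_ract.
Defined.

Definition to_hom_rhom : rhom (com_mod M) (HomTB N).
Proof.
exists to_hom; split=> [m n|m t]; apply: rhom_eq => x /=.
  by rewrite TB_indDl (rhomD f).
by rewrite TB_ind_lact.
Defined.

Definition to_coind : chom M (CoindTB N) := rat_lift alphaP to_hom_rhom.
End ToCoind.

Section OfCoind.
Variable g : chom M (CoindTB N).

Definition eval_coind (m : M) (b : balg beta) : N :=
  (rat_val (g m) : rhom (TB_bim X) (com_mod N)) (((1 : T) : ar_bim T) ⊗ b : TB beta T).

(** T-linearity of [g] gives [g(m t) = g(m) t], here evaluated at [1 ⊗ b]; hence [eval_coind]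
    determines [g]. *)
Lemma coind_lin m (t : ar_bim T) (b : balg beta) :
  (rat_val (g m) : rhom (TB_bim X) (com_mod N)) (t ⊗ b : TB beta T) =
  eval_coind (com_ract m t) b.
Proof.
rewrite /eval_coind chom_com_ract com_ract_rat /=.
by rewrite [TB_lact _ _](@tpure_lact _ _ _ (ar_bimTA T) (balg beta)) /= mulr1.
Qed.

Lemma eval_coind_bal : balanced eval_coind.
Proof.
split=> [m n b|m b b'|m a b]; rewrite /eval_coind.
- by rewrite (rhomD g).
- by rewrite tpureDr (rhomD (rat_val (g m) : rhom (TB_bim X) (com_mod N))).
- rewrite -[LHS]/(eval_coind (m <* a) b) -com_ract_unit -coind_lin.
  rewrite -[ar_unit T a]mul1r -ar_ractE.
  apply: (congr1 (rat_val (g m) : rhom (TB_bim X) (com_mod N))).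
  exact: tpure_bal.
Qed.

Lemma eval_coind_ract (x : ind M) s :
  tlift eval_coind (com_ract x s : ind M) = com_ract (tlift eval_coind x) s.
Proof.
have bal := eval_coind_bal.
elim/tens_ind: x => [m b|x y]; last first.
  by rewrite com_ractDl !(tliftD bal) com_ractDl => -> ->.
rewrite ind_com_ract !(tlift_pure _ _ bal) -coind_lin.
(* [ξ(s) ⊗ b] is [(1 ⊗ b) s], and [g m] is S-linear. *)
rewrite -[xi s]mul1r -(TB_ractE X).
exact: (rhomZ (rat_val (g m) : rhom (TB_bim X) (com_mod N))).
Qed.

Definition of_coind : chom (ind M) N :=
  @chom_of_linear _ _ alphaQ (ind M) N _ (tliftD eval_coind_bal) eval_coind_ract.
End OfCoind.

Lemma to_coindK : cancel to_coind of_coind.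
Proof.
move=> f; apply: chom_eq; apply: (tens_ext (f := of_coind (to_coind f))).
- exact: rhomD.
- exact: rhomD.
move=> m b; rewrite [LHS](tlift_pure _ _ (eval_coind_bal _)).
by rewrite /eval_coind /= TB_ind_pure com_ract1.
Qed.

Lemma of_coindK : cancel of_coind to_coind.
Proof.
move=> g; apply: chom_eq => m; apply: rat_inj; apply: rhom_eq.
pose h k : rhom (TB_bim X) (com_mod N) := rat_val (chom_fun k m : CoindTB N).
apply: (tens_ext (rhomD (h (to_coind (of_coind g)))) (rhomD (h g))) => t b.
rewrite /h {h}.
rewrite [RHS]coind_lin /= TB_ind_pure.
exact: tlift_pure (eval_coind_bal g).
Qed.
End Bijection.

(** * Naturality of the bijection *)

Lemma Ind_Coind_adjoint :
  adjoint_pair (Ind_functor (pairing_mor_coring morP))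
    (functor_comp (functor_comp (Rat_functor alphaP) (Hom_functor (TB_bim X)))
       (com_embedding Q)).
Proof.
exists to_coind; split=> [M N|M' M N u f|M N N' v f].
- exact: Bijective (@to_coindK M N) (@of_coindK M N).
- apply: chom_eq => m; apply: rat_inj; apply: rhom_eq => x /=.
  (* Both sides are values of [f]; the arguments agree because [u] commutes with the T-action, hence
     with orbit maps. *)
  congr (rhom_fun _ _).
  have iB := @llin_id _ _ (balg beta); have uP := rhomP u.
  elim/tens_ind: x => [t b|x y].
    by rewrite !TB_ind_pure tmap_pure // chom_com_ract.
  by rewrite !TB_indD tmapD // => -> ->.
- by apply: chom_eq => m; apply: rat_inj; apply: rhom_eq.
Qed.
End Adjunction.

Theorem theorem4p5 (R : comNzRingType) (A B : ralgebra R)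
    (beta : {rmorphism A -> B}) (betaP : is_ralg_mor beta)
    (P : measuring_pairing A) (Q : measuring_pairing B)
    (alphaP : is_alpha_pairing P) (alphaQ : is_alpha_pairing Q)
    (xi : mp_ring Q -> mp_ring P) (theta : mp_coring P -> mp_coring Q)
    (morP : is_pairing_mor beta xi theta)
    (X : TB_structure beta xi) :
  exists (HOM : functor (RMod (mp_ring Q)) (Comod (mp_coring P)))
         (Coind : functor (Comod (mp_coring Q)) (Comod (mp_coring P))),
    [/\ HOM = functor_comp (Rat_functor alphaP) (Hom_functor (TB_bim X)),
        Coind = functor_comp HOM (com_embedding Q) &
        adjoint_pair (Ind_functor (pairing_mor_coring morP)) Coind].
Proof.
exists (functor_comp (Rat_functor alphaP) (Hom_functor (TB_bim X))).
exists (functor_comp (functor_comp (Rat_functor alphaP) (Hom_functor (TB_bim X)))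
         (com_embedding Q)).
by split=> //; apply: Ind_Coind_adjoint.
Qed.
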